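(* For every $\delta>0$ there is $c=c(\delta)>0$ such that the following holds. Let $G$ be a compact vector space over $\mathbb{F}_2$, let $M\ge 16$, and let $A\subset G$ be a measurable set of density $\alpha$ such that for every finite subgroup $V\le\widehat G$ with $|V|\le M$, \[ \{\alpha|V|\}\bigl(1-\{\alpha|V|\}\bigr)\ \ge\ \delta . \] Then $\|\chi_A\|_{A(G)}\ge c\log\log M$.
   Context: A compact vector space over $\mathbb{F}_2$ is a compact Hausdorff abelian group $G$ with $x+x=0$ for all $x$; its dual $\widehat G$ (continuous homomorphisms $G\to S^1$, written additively) is a discrete $\mathbb{F}_2$-vector space. $\mu_G$ is Haar probability measure; the density of $A$ is $\mu_G(A)$. $\widehat f(\gamma)=\int_G f\overline{\gamma}\,d\mu_G$, and $\|f\|_{A(G)}=\sum_{\gamma\in\widehat G}|\widehat f(\gamma)|$ (possibly $+\infty$). $\{t\}$ denotes the fractional part of a real number $t$. *)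

(* Defs.v *)
(* MathComp-Analysis (topology, measure theory, Lebesgue integration). *)
From HB Require Import structures.
From mathcomp Require Import all_boot all_order all_algebra.
From mathcomp Require Import all_classical all_reals all_analysis.
From mathcomp Require Import complex.
Import Order.TTheory GRing.Theory Num.Theory ComplexField.
Import numFieldNormedType.Exports numFieldTopology.Exports.

Set Implicit Arguments.
Unset Strict Implicit.
Unset Printing Implicit Defensive.

Local Open Scope ring_scope.
Local Open Scope classical_set_scope.

(* Borel sigma-algebra on a topological abelian group G *)
(* Copy of G with a (irrelevant) distinguished point 0, needed by the
   generated-sigma-algebra construction of MathComp-Analysis. *)
Definition Gp (G : topologicalZmodType) : Type := G.
HB.instance Definition _ (G : topologicalZmodType) := Topological.on (Gp G).
HB.instance Definition _ (G : topologicalZmodType) := GRing.Zmodule.on (Gp G).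
HB.instance Definition _ (G : topologicalZmodType) := isPointed.Build (Gp G) 0.
Notation borel G := (g_sigma_algebraType (@open (Gp G))).


(* G is a compact vector space over F_2: a compact Hausdorff topological
   abelian group in which x + x = 0 for every x. *)
Definition compact_F2_space (G : topologicalZmodType) : Prop :=
  [/\ compact [set: G], hausdorff_space G & forall x : G, x + x = 0].

(* mu is the Haar probability measure of G: a Radon (inner regular by compact
   sets) translation-invariant Borel probability measure. *)
Definition haar_probability (R : realType) (G : topologicalZmodType)
    (mu : {measure set (borel G) -> \bar R}) : Prop :=
  [/\ mu setT = 1%E,
      (forall (x : G) (B : set (borel G)), measurable B ->
         mu [set x + y | y in B] = mu B) &
      (forall B : set (borel G), measurable B ->
         mu B = ereal_sup [set mu K | K in [set K : set G | compact K /\ K `<=` B]])].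

(* Characters: continuous homomorphisms G -> S^1 (unit circle of C = R[i]),
   with G written additively and S^1 multiplicatively. *)
Definition character (R : realType) (G : topologicalZmodType) (g : G -> (R[i])^o) : Prop :=
  [/\ continuous g,
      (forall x, `|g x| = 1) &
      (forall x y, g (x + y) = g x * g y)].

(* The dual group \hat G as a set of functions. *)
Definition dual (R : realType) (G : topologicalZmodType) : set (G -> R[i]) :=
  [set g | character g].

(* Complex-valued integral, defined through real and imaginary parts. *)
Definition cintegral (R : realType) (G : topologicalZmodType)
    (mu : {measure set (borel G) -> \bar R}) (f : G -> R[i]) : R[i] :=
  ((Rintegral mu setT (fun x => complex.Re (f x)))%:C
  + 'i * (Rintegral mu setT (fun x => complex.Im (f x)))%:C)%C.

(* Fourier coefficient  \hat f(gamma) = \int_G f \bar gamma d mu. *)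
Definition fourier (R : realType) (G : topologicalZmodType)
    (mu : {measure set (borel G) -> \bar R}) (f : G -> R[i]) (g : G -> R[i]) : R[i] :=
  cintegral mu (fun x => f x * (g x)^*).

(* Indicator function chi_A, complex valued. *)
Definition cindic (R : realType) (G : topologicalZmodType) (A : set G) : G -> R[i] :=
  fun x => ((\1_A x : R)%:C)%C.

(* Wiener algebra norm  ||f||_{A(G)} = sum_{gamma in \hat G} |\hat f(gamma)|, in \bar R. *)
Definition Anorm (R : realType) (G : topologicalZmodType)
    (mu : {measure set (borel G) -> \bar R}) (f : G -> R[i]) : \bar R :=
  esum (@dual R G) (fun g => (ComplexField.Normc.normc (fourier mu f g))%:E).

(* V is a finite subgroup of \hat G (group law: pointwise product). *)
Definition finite_subgroup_dual (R : realType) (G : topologicalZmodType)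
    (V : set (G -> R[i])) : Prop :=
  [/\ finite_set V, V `<=` @dual R G,
      V (fun _ => 1),
      (forall g h, V g -> V h -> V (fun x => g x * h x)) &
      (forall g, V g -> V (fun x => (g x)^-1))].

(* Fractional part {t} = t - floor t. *)
Definition fracpart (R : realType) (t : R) : R := t - (Num.floor t)%:~R.

(* Cardinality of a finite set of characters (a natural number). *)
Definition card_set (R : realType) (G : topologicalZmodType) (V : set (G -> R[i])) : nat :=
  size (finmap.enum_fset (fset_set V)).

(* Main.v *)
(** For a finite subgroup V of the dual let f_V be the conditional expectation of
    chi_A on the cosets of the annihilator of V. Subadditivity of
    t |-> {t}(1 - {t}) turns the hypothesis into eta := E f_V (1 - f_V) >= delta / |V|,
    which is the l2-mass of the Fourier transform of chi_A outside V, while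
    chi_A - f_V has L1-norm at most 2 eta. A dyadic decomposition gives i >= 1 for
    which the frequencies outside V with coefficient above 2^-i (2 eta) carry
    l1-mass at least i / 16; by Chang's inequality they span at most
    O(4^i log (1 / eta)) new dimensions. Adding them to V multiplies the dimension
    by O(1)^i for a gain of i / 16, and iterating until |V| > M yields log log M.

    All this takes place in a finite quotient of G on which A is nearly a union of
    fibres. Such quotients exist because every neighbourhood U of 0 contains an open
    subgroup: Bogolyubov's theorem in the finite subgroups F of G gives subgroups of
    F of bounded index inside 4C, for a small neighbourhood C of 0, and the closure
    of their limit along an ultrafilter has finite index and lies in U. *)
Require Import Defs.
From HB Require Import structures.
From mathcomp Require Import all_boot all_order all_algebra.
From mathcomp Require Import all_classical all_reals all_analysis.
From mathcomp Require Import complex.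
From mathcomp Require Import measurable_realfun ring lra.
Import Order.TTheory GRing.Theory Num.Theory ComplexField.
Import numFieldNormedType.Exports numFieldTopology.Exports.
Local Open Scope ring_scope.
Local Open Scope classical_set_scope.

Set Implicit Arguments.
Unset Strict Implicit.
Unset Printing Implicit Defensive.

(** * Fourier analysis on finite F_2-spaces *)

(* A symmetric nondegenerate pairing identifies the finite F_2-space [T] with its
   dual, so that both variables and frequencies range over [T]. *)
Definition f2_pairing (T : finZmodType) (p : T -> T -> bool) : Prop :=
  [/\ forall x y, p x y = p y x,
      forall w x y, p w (x + y) = p w x (+) p w y &
      forall x, x != 0 -> exists w, p w x].

Definition subgrp (T : finZmodType) (V : {set T}) : Prop :=
  0 \in V /\ {in V &, forall x y, x + y \in V}.

Section FiniteFourier.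
Variables (R : realType) (T : finZmodType) (p : T -> T -> bool).
Hypothesis hp : f2_pairing p.

Let pC x y : p x y = p y x. Proof. by case: hp. Qed.
Let pDr w x y : p w (x + y) = p w x (+) p w y. Proof. by case: hp. Qed.
Let pnd (x : T) : x != 0 -> exists w, p w x. Proof. by case: hp => _ _; apply. Qed.

Definition chi (w x : T) : R := (-1) ^+ p w x.

Local Notation N := (#|T|%:R : R).

Lemma card_gt0R : 0 < N.
Proof. by rewrite ltr0n; apply/card_gt0P; exists 0. Qed.

Lemma addxx (x : T) : x + x = 0.
Proof.
apply/eqP/contraT => /pnd [w]; rewrite pDr; by case: (p w x).
Qed.

Lemma addxxK (x y z : T) : x + y + (y + z) = x + z.
Proof. by rewrite addrA -(addrA x) addxx addr0. Qed.

Lemma chi_eq1 w x : p w x = false -> chi w x = 1.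
Proof. by rewrite /chi => ->. Qed.

Lemma chiC w x : chi w x = chi x w. Proof. by rewrite /chi pC. Qed.

Lemma chiDr w x y : chi w (x + y) = chi w x * chi w y.
Proof. by rewrite /chi pDr signr_addb. Qed.

Lemma chiDl w v x : chi (w + v) x = chi w x * chi v x.
Proof. by rewrite !(chiC _ x) chiDr. Qed.

Lemma chiK w x : chi w x * chi w x = 1.
Proof. by rewrite /chi -expr2 sqrr_sign. Qed.

Lemma chi0r w : chi w 0 = 1.
Proof. by rewrite -(chiK w 0) -chiDr addr0. Qed.

Lemma chi0l x : chi 0 x = 1.
Proof. by rewrite chiC chi0r. Qed.

Lemma normr_chi w x : `|chi w x| = 1.
Proof. by rewrite /chi normrX normrN1 expr1n. Qed.

Lemma sum_shift (F : T -> R) (y : T) : \sum_x F (x + y) = \sum_x F x.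
Proof.
by rewrite [RHS](reindex_inj (addIr y)).
Qed.

(** For nonzero [x], translating [w] by some [v] with [p v x] flips the sign of every term, so the
    sum is its own negative. *)
Lemma sum_chi x : \sum_w chi w x = N *+ (x == 0).
Proof.
have [->|x0] := eqVneq x 0.
  by under eq_bigr do rewrite chi0r; rewrite sumr_const mulr1n.
have [v pv] := pnd x0; rewrite mulr0n.
have := sum_shift (fun w => chi w x) v; under eq_bigr do rewrite chiDl.
by rewrite -big_distrl /= {2}/chi pv expr1; lra.
Qed.

Definition mean (f : T -> R) : R := N^-1 * \sum_x f x.
Definition hat (f : T -> R) (w : T) : R := mean (fun x => f x * chi w x).

Lemma eq_mean f g : f =1 g -> mean f = mean g.
Proof. by move=> fg; rewrite /mean (eq_bigr _ (fun i _ => fg i)). Qed.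

Lemma eq_hat f g w : f =1 g -> hat f w = hat g w.
Proof. by move=> fg; apply: eq_mean => x; rewrite fg. Qed.

Lemma meanD f g : mean (fun x => f x + g x) = mean f + mean g.
Proof. by rewrite /mean big_split /= mulrDr. Qed.

Lemma meanZ a f : mean (fun x => a * f x) = a * mean f.
Proof. by rewrite /mean -big_distrr /= mulrCA. Qed.

Lemma meanB f g : mean (fun x => f x - g x) = mean f - mean g.
Proof. by rewrite /mean sumrB mulrBr. Qed.

Lemma mean_cst a : mean (fun=> a) = a.
Proof.
by rewrite /mean sumr_const -[a *+ _]mulr_natl mulrA mulVf ?mul1r ?gt_eqF ?card_gt0R.
Qed.

Lemma mean_sum (I : Type) (r : seq I) (P : pred I) (F : I -> T -> R) :
  mean (fun x => \sum_(i <- r | P i) F i x) = \sum_(i <- r | P i) mean (F i).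
Proof.
rewrite /mean exchange_big /= big_distrr /=; by apply: eq_bigr.
Qed.

Lemma ler_mean f g : (forall x, f x <= g x) -> mean f <= mean g.
Proof.
move=> fg; rewrite /mean ler_pM2l ?invr_gt0 ?card_gt0R //; exact: ler_sum.
Qed.

Lemma ler_norm_mean f : `|mean f| <= mean (fun x => `|f x|).
Proof.
rewrite /mean normrM gtr0_norm ?invr_gt0 ?card_gt0R //.
by rewrite ler_pM2l ?invr_gt0 ?card_gt0R // ler_norm_sum.
Qed.

Lemma mean_chi w : mean (chi w) = (w == 0)%:R.
Proof.
rewrite /mean; under eq_bigr do rewrite chiC; rewrite sum_chi.
by case: (w == 0); rewrite ?mulr1n ?mulr0n ?mulr0 ?mulVf ?gt_eqF ?card_gt0R.
Qed.

Lemma hat0 f : hat f 0 = mean f.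
Proof. by apply: eq_mean => x; rewrite chi0l mulr1. Qed.

Lemma hat_chi v w : hat (chi v) w = (v == w)%:R.
Proof.
rewrite /hat (@eq_mean _ (chi (v + w))) => [|x]; last by rewrite chiDl.
rewrite mean_chi -(inj_eq (addIr w)) -addrA addxx addr0 add0r //.
Qed.

Lemma hatD f g w : hat (fun x => f x + g x) w = hat f w + hat g w.
Proof. by rewrite -meanD; apply: eq_mean => x; rewrite mulrDl. Qed.

Lemma hatB f g w : hat (fun x => f x - g x) w = hat f w - hat g w.
Proof. by rewrite -meanB; apply: eq_mean => x; rewrite mulrBl. Qed.

Lemma hatM_chi f v w : hat (fun x => chi v x * f x) w = hat f (v + w).
Proof. by apply: eq_mean => x; rewrite chiDl; ring. Qed.

Lemma hatZ a f w : hat (fun x => a * f x) w = a * hat f w.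
Proof. by rewrite -meanZ; apply: eq_mean => x; rewrite mulrA. Qed.

Lemma fourier_inversion f x : f x = \sum_w hat f w * chi w x.
Proof.
under eq_bigr => w _ do rewrite /hat /mean -mulrA big_distrl /=.
rewrite -big_distrr /= exchange_big /=.
under eq_bigr => y _.
  under eq_bigr => w _ do rewrite -mulrA -chiDr.
  rewrite -big_distrr /= sum_chi; over.
rewrite (bigD1 x) //= addxx eqxx mulr1n big1 ?addr0 => [|y yx].
  by rewrite mulrCA mulVf ?mulr1 ?gt_eqF ?card_gt0R.
by rewrite -(inj_eq (addIr x)) -addrA addxx addr0 add0r (negbTE yx) mulr0n mulr0.
Qed.

Lemma plancherel f g : mean (fun x => f x * g x) = \sum_w hat f w * hat g w.
Proof.
rewrite (@eq_mean _ (fun x => \sum_w hat f w * (g x * chi w x))).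
  by rewrite mean_sum; apply: eq_bigr => w _; rewrite meanZ.
move=> x; rewrite {1}(fourier_inversion f) big_distrl /=.
by apply: eq_bigr => w _; ring.
Qed.

(** For a subgroup [V] this is the conditional expectation of [f] on the cosets of [perp V], as
    [projE] shows. The spectral form makes its Fourier transform immediate. *)
Definition proj (V : {set T}) (f : T -> R) (x : T) : R :=
  \sum_(w in V) hat f w * chi w x.

Lemma hat_proj V f w : hat (proj V f) w = if w \in V then hat f w else 0.
Proof.
rewrite /hat (@eq_mean _ (fun x => \sum_(v in V) hat f v * (chi v x * chi w x))).
  rewrite mean_sum; under eq_bigr => v _ do rewrite meanZ -/(hat _ _) hat_chi.
  case: ifPn => [wV|wV].
    rewrite (bigD1 w) //= eqxx mulr1 big1 ?addr0 // => v /andP[_ /negbTE ->].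
    by rewrite mulr0.
  rewrite big1 // => v vV; case: eqP => [vw|_]; last by rewrite mulr0.
  by rewrite -vw vV in wV.
by move=> x; rewrite /proj big_distrl /=; apply: eq_bigr => v _; rewrite mulrA.
Qed.

Definition perp (V : {set T}) : {set T} := [set x | [forall w in V, ~~ p w x]].

Lemma perpP (V : {set T}) x : reflect (forall w, w \in V -> p w x = false) (x \in perp V).
Proof.
rewrite inE; apply: (iffP forallP) => [h w wV|h w].
  by have := h w; rewrite wV /= => /negbTE.
by apply/implyP => /h ->.
Qed.

Lemma perp_add V x y : x \in perp V -> y \in perp V -> x + y \in perp V.
Proof.
move=> /perpP hx /perpP hy; apply/perpP => w wV.
by rewrite pDr hx // hy.
Qed.

Lemma sum_chi_sub V x : subgrp V ->
  \sum_(w in V) chi w x = (#|V|%:R : R) *+ (x \in perp V).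
Proof.
move=> [V0 VD]; have [/perpP h|h] := boolP (x \in perp V).
  under eq_bigr => w wV do rewrite /chi h // expr0.
  by rewrite sumr_const mulr1n.
have [v vV pv] : exists2 v, v \in V & p v x.
  move: h; rewrite inE negb_forall => /existsP[v].
  by rewrite negb_imply negbK => /andP[]; exists v.
rewrite mulr0n.
have E : \sum_(w in V) chi w x = \sum_(w in V) chi (w + v) x.
  rewrite (reindex_inj (addIr v)) /=; apply: eq_bigl => w.
  apply/idP/idP => wV; last exact: VD.
  by rewrite -[w]addr0 -(addxx v) addrA VD.
move: E; under [RHS]eq_bigr do rewrite chiDl.
by rewrite -big_distrl /= {3}/chi pv expr1; lra.
Qed.

Lemma projE V f x : subgrp V ->
  proj V f x = N^-1 * (#|V|%:R * \sum_(y | x + y \in perp V) f y).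
Proof.
move=> sV; rewrite /proj.
under eq_bigr => w _ do rewrite /hat /mean -mulrA big_distrl /=.
rewrite -big_distrr /= exchange_big /=; congr (_ * _).
under eq_bigr => y _.
  under eq_bigr => w _ do rewrite -mulrA [chi w y * _]mulrC -chiDr.
  rewrite -big_distrr /= sum_chi_sub //; over.
rewrite [in RHS]big_mkcond big_distrr /=; apply: eq_bigr => y _.
by case: ifP; rewrite ?mulr1n ?mulr0n ?mulr0 // mulrC.
Qed.

(** Compute the mean of the sum of all [chi w], [w] in [V], in two ways: only [w = 0] has nonzero
    mean, while pointwise the sum is [#|V|] on [perp V] and [0] elsewhere. *)
Lemma card_perp V : subgrp V -> #|V|%:R * #|perp V|%:R = N.
Proof.
move=> sV; have := mean_cst 1; have : mean (fun x => \sum_(w in V) chi w x) = 1.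
  rewrite mean_sum (bigD1 0) /=; last by case: sV.
  rewrite mean_chi eqxx big1 ?addr0 // => w /andP[_ /negbTE w0].
  by rewrite mean_chi w0.
rewrite /mean; under eq_bigr do rewrite sum_chi_sub // mulrb.
rewrite -big_mkcond /= sumr_const => + _.
rewrite -[_ *+ #|_|]mulr_natr => /(congr1 (fun z => N * z)).
by rewrite mulr1 mulVKf ?gt_eqF ?card_gt0R.
Qed.

Lemma subgrp_card_gt0 (V : {set T}) : subgrp V -> 0 < (#|V|%:R : R).
Proof. by case=> V0 _; rewrite ltr0n; apply/card_gt0P; exists 0. Qed.

Lemma card_coset_perp V x : #|[pred y | x + y \in perp V]| = #|perp V|.
Proof.
rewrite -(card_imset (mem (perp V)) (addrI x)); apply: eq_card => y.
rewrite inE; apply/idP/imsetP => [h|[z zV ->]]; last by rewrite addrA addxx add0r.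
by exists (x + y) => //; rewrite addrA addxx add0r.
Qed.

Lemma proj_ge0 V f x : subgrp V -> (forall y, 0 <= f y) -> 0 <= proj V f x.
Proof.
move=> sV f0; rewrite projE // mulr_ge0 ?invr_ge0 ?mulr_ge0 //.
exact: sumr_ge0.
Qed.

Lemma proj_le1 V f x : subgrp V -> (forall y, f y <= 1) -> proj V f x <= 1.
Proof.
move=> sV f1; rewrite projE // ler_pdivrMl ?card_gt0R // mulr1.
rewrite -[leRHS](card_perp sV) ler_pM2l ?subgrp_card_gt0 //.
apply: le_trans (_ : \sum_(y | x + y \in perp V) 1 <= _); first exact: ler_sum.
by rewrite sumr_const card_coset_perp.
Qed.

Lemma proj_coset V f x y : subgrp V -> x + y \in perp V -> proj V f x = proj V f y.
Proof.
move=> sV xy; rewrite !projE //; congr (_ * (_ * _)); apply: eq_bigl => z.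
apply/idP/idP => h.
  by have := perp_add xy h; rewrite addrACA addxx add0r.
by have := perp_add xy h; rewrite [x + y]addrC addrACA addxx add0r.
Qed.


(** Lists each coset of [perp V] once, so that the sum over cosets has a form to which
    [sawtooth_sum] applies. *)
Lemma sum_cosets V : subgrp V -> exists (P : {set {set T}}) (rep : {set T} -> T),
  forall F : T -> R, (forall x y, x + y \in perp V -> F x = F y) ->
  \sum_x F x = #|perp V|%:R * \sum_(C in P) F (rep C).
Proof.
move=> sV.
pose cls x : {set T} := [set y | x + y \in perp V]%SET.
have clsE x y : (y \in cls x) = (x + y \in perp V) by rewrite finset.in_set.
have clsxx x : x \in cls x.
  by rewrite clsE addxx; apply/perpP => w _; have := pDr w 0 0; rewrite addr0; case: (p w 0).
have clsP x y : (cls y == cls x) = (y \in cls x).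
  apply/eqP/idP => [<- //|]; rewrite clsE => xy; apply/setP => z; rewrite !clsE.
  apply/idP/idP => h; first by have := perp_add xy h; rewrite addxxK.
  by have := perp_add xy h; rewrite [x + y]addrC addxxK.
exists [set cls x | x in T]%SET, (fun C : {set T} => odflt (0 : T) [pick x in C]) => F hF.
rewrite (partition_big cls (mem [set cls x | x in T]%SET)) /=; last first.
  by move=> x _; apply: imset_f.
rewrite big_distrr /=; apply: eq_bigr => _ /imsetP[x _ ->].
under eq_bigl do rewrite clsP.
case: pickP => [y|/(_ x)]; last by rewrite clsxx.
rewrite /= => yx; rewrite (eq_bigr (fun=> F y)) => [|z zx].
  rewrite sumr_const -[_ *+ _]mulr_natl; congr (_%:R * _).
  by rewrite -(card_coset_perp V x); apply: eq_card => z; rewrite clsE.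
apply: hF; move: yx zx; rewrite !clsE => yx zx.
by have := perp_add zx yx; rewrite [x + z]addrC addxxK.
Qed.

End FiniteFourier.

(** * Fractional parts *)

Section FracPart.
Variable R : realType.

Definition sawtooth (t : R) : R := fracpart t * (1 - fracpart t).

Lemma fracpart_itv (t : R) : 0 <= fracpart t < 1.
Proof.
rewrite /fracpart subr_ge0 ltrBlDl floor_le_tmp /=.
by have := floorD1_gt t; rewrite intrD.
Qed.

Lemma fracpart_unique (t a : R) (m : int) :
  t = m%:~R + a -> 0 <= a < 1 -> fracpart t = a.
Proof.
move=> -> /andP[a0 a1]; rewrite /fracpart (@floor_def _ _ m); first by ring.
by rewrite intrD lerDl a0 ltrD2l a1.
Qed.

Lemma sawtooth_itv (t : R) : 0 <= t <= 1 -> sawtooth t = t * (1 - t).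
Proof.
case/andP; rewrite le_eqVlt => /orP[/eqP <-|t0].
  by rewrite /sawtooth (@fracpart_unique _ 0 0) ?lexx ?ltr01 ?addr0.
rewrite le_eqVlt => /orP[/eqP ->|t1].
  by rewrite /sawtooth (@fracpart_unique _ 0 1) ?lexx ?ltr01 ?addr0 //; ring.
by rewrite /sawtooth (@fracpart_unique _ t 0) ?add0r ?ltW.
Qed.

(** With fractional parts [a] and [b], the right side exceeds the left by [2 * a * b] if
    [a + b < 1], and by [2 * (1 - a) * (1 - b)] otherwise. *)
Lemma sawtoothD (s t : R) : sawtooth (s + t) <= sawtooth s + sawtooth t.
Proof.
have /andP[a0 a1] := fracpart_itv s; have /andP[b0 b1] := fracpart_itv t.
have es : s = (Num.floor s)%:~R + fracpart s by rewrite /fracpart; ring.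
have et : t = (Num.floor t)%:~R + fracpart t by rewrite /fracpart; ring.
rewrite /sawtooth.
set a := fracpart s in a0 a1 es *; set b := fracpart t in b0 b1 et *.
have [ab|ab] := ltP (a + b) 1.
  rewrite (@fracpart_unique _ (a + b) (Num.floor s + Num.floor t)).
  - by nra.
  - by rewrite intrD {1}es {1}et; ring.
  - by lra.
rewrite (@fracpart_unique _ (a + b - 1) (Num.floor s + Num.floor t + 1)).
- by nra.
- by rewrite !intrD {1}es {1}et; ring.
- by lra.
Qed.

Lemma sawtooth_sum (I : Type) (r : seq I) (P : pred I) (F : I -> R) :
  (forall i, 0 <= F i <= 1) ->
  sawtooth (\sum_(i <- r | P i) F i) <= \sum_(i <- r | P i) F i * (1 - F i).
Proof.
move=> F01; elim/big_rec2: _ => [|i y x _ h].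
  by rewrite sawtooth_itv ?lexx ?ler01 // mul0r.
by apply: le_trans (sawtoothD _ _) _; rewrite sawtooth_itv // lerD2l.
Qed.

End FracPart.

(** * Riesz products and Chang's inequality *)

Section RieszProducts.
Variables (R : realType) (T : finZmodType) (p : T -> T -> bool).
Hypothesis hp : f2_pairing p.
Local Notation chi := (chi R p).
Local Notation hat := (@hat R T p).

(** For a subgroup [V] this is the span of [V] and [s]: in exponent two, a new generator contributes
    only one further translate. *)
Fixpoint extend (V : {set T}) (s : seq T) : {set T} :=
  if s is l :: s' then extend V s' :|: [set l + u | u in extend V s']%SET else V.

(** For a subgroup [V], linear independence of [s] in the quotient by [V]. *)
Fixpoint free_over (V : {set T}) (s : seq T) : bool :=
  if s is l :: s' then (l \notin extend V s') && free_over V s' else true.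

Lemma extend_subgrp (V : {set T}) s : subgrp V -> subgrp (extend V s).
Proof.
move=> sV; elim: s => [//|l s [U0 UD]] /=; split; first by rewrite inE U0.
have xx := addxx hp.
move=> x y; rewrite !inE => /orP[xU|/imsetP[u uU ->]] /orP[yU|/imsetP[v vU ->]].
- by rewrite UD.
- by apply/orP; right; apply/imsetP; exists (x + v); rewrite ?UD // addrCA.
- by apply/orP; right; apply/imsetP; exists (u + y); rewrite ?UD // addrA.
- by rewrite addrACA xx add0r UD.
Qed.

Lemma sub_extend (V : {set T}) s : V \subset extend V s.
Proof.
by elim: s => [//|l s IH] /=; apply: fintype.subset_trans IH (finset.subsetUl _ _).
Qed.

Lemma card_extend (V : {set T}) s : subgrp V -> free_over V s ->
  #|extend V s| = (#|V| * 2 ^ size s)%N.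
Proof.
move=> sV; elim: s => [|l s IH] /=; first by rewrite muln1.
case/andP=> lU /IH E; rewrite expnS mulnCA -E cardsU.
have -> : extend V s :&: [set l + u | u in extend V s]%SET = finset.set0.
  apply/setP => x; rewrite !inE; apply/negP => /andP[xU /imsetP[u uU xE]].
  have [_ UD] := extend_subgrp s sV.
  by move: lU; rewrite -[l]addr0 -(addxx hp u) addrA -xE UD.
by rewrite cards0 subn0 (card_imset _ (addrI l)) mul2n addnn.
Qed.

Definition riesz (a : T -> R) (s : seq T) (x : T) : R :=
  \prod_(l <- s) (1 + a l * chi l x).

(** A factor for [l] adds a copy of the spectrum translated by [l]. Freeness keeps this copy
    disjoint from [extend V s], so it never reaches the frequency [0]. *)
Lemma hat_riesz (V : {set T}) a s : subgrp V -> free_over V s ->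
  hat (riesz a s) 0 = 1 /\ forall w, w \notin extend V s -> hat (riesz a s) w = 0.
Proof.
move=> sV; elim: s => [|l s IH] /=.
  have e w : hat (riesz a [::]) w = (0 == w)%:R.
    rewrite -(hat_chi R hp); apply: eq_hat => x.
    by rewrite /riesz big_nil chi0l.
  move=> _; split; first by rewrite e eqxx.
  move=> w; rewrite e; case: eqP => // <-; by case: sV => ->.
case/andP=> lU /IH [h0 hU].
have e w : hat (riesz a (l :: s)) w = hat (riesz a s) w + a l * hat (riesz a s) (l + w).
  rewrite -(hatM_chi hp) -hatZ -hatD; apply: eq_hat => x.
  by rewrite /riesz big_cons; ring.
split=> [|w]; first by rewrite e h0 addr0 hU // mulr0 addr0.
rewrite inE negb_or e => /andP[wU wI]; rewrite hU // hU ?mulr0 ?addr0 //.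
apply: contra wI => lw; apply/imsetP; exists (l + w) => //.
by rewrite addrA (addxx hp) add0r.
Qed.

(** With [w = u - 2 * u ^+ 2], [expR (- w) >= 1 - w] reduces the claim to [(1 + u) * (1 - w) >= 1].
    The left side is [1 + u ^+ 2 * (1 + 2 * u)]. *)
Lemma expR_le1D (u : R) : `|u| <= 1 / 2 -> expR (u - 2 * u ^+ 2) <= 1 + u.
Proof.
rewrite ler_norml => /andP[u1 u2].
have := @expR_ge1Dx R (- (u - 2 * u ^+ 2)); rewrite expRN.
have E0 := expR_gt0 (u - 2 * u ^+ 2).
set w := u - 2 * u ^+ 2 in E0 * => h.
have w1 : 0 < 1 - w by rewrite /w; nra.
have h1 : (1 - w) * expR w <= 1.
  by rewrite -ler_pdivlMr // mul1r.
have h2 : 1 <= (1 + u) * (1 - w) by rewrite /w; nra.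
rewrite -(ler_pM2l w1); apply: le_trans h1 _; by rewrite mulrC.
Qed.

Lemma riesz_ge (t : R) (g : T -> R) s x : 0 <= t <= 1 / 2 ->
  (forall l, `|g l| <= 1) ->
  expR (t * \sum_(l <- s) g l * chi l x - 2 * (size s)%:R * t ^+ 2)
    <= riesz (fun l => t * g l) s x.
Proof.
move=> /andP[t0 t1] g1; elim: s => [|l s IH].
  by rewrite /riesz !big_nil !mulr0 !mul0r subrr expR0.
rewrite /riesz !big_cons -/(riesz _ _ _).
set S := \sum_(j <- s) _ in IH *.
have u1 : `|t * g l * chi l x| <= t.
  by rewrite !normrM normr_chi mulr1 (ger0_norm t0) ler_piMr.
have e1 := @expR_le1D (t * g l * chi l x) (le_trans u1 t1).
apply: le_trans (ler_pM (expR_ge0 _) (expR_ge0 _) e1 IH).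
rewrite -expRD ler_expR /= -natr1.
have : (t * g l * chi l x) ^+ 2 <= t ^+ 2.
  by rewrite -real_normK ?num_real // ler_sqr ?nnegrE.
by nra.
Qed.

(* Chang's inequality. Riesz products dominate [expR (t * |P|)], where [P] is
   the signed sum of the characters of [s]; this bounds the correlation of [P]
   with [f], hence the number of large independent Fourier coefficients. *)
Lemma chang (V : {set T}) (f : T -> R) (eta e : R) s :
  subgrp V -> free_over V s -> (forall x, `|f x| <= 1) ->
  mean (fun x => `|f x|) <= 2 * eta -> 0 < eta <= 1 / 4 -> 0 < e <= 2 ->
  (forall l, l \in s -> e * eta <= `|hat f l|) ->
  (size s)%:R * e ^+ 2 <= 32 * ln (2 / eta).
Proof.
move=> sV fs f1 fm /andP[eta0 eta1] /andP[e0 e2] hl.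
have d0 : 0 < 2 / eta by rewrite divr_gt0.
set k : R := (size s)%:R; have k0 : 0 <= k by rewrite /k.
(* If [k * e ^+ 2 <= 8], the bound follows from [ln (2 / eta) >= 1 - eta / 2 >= 7 / 8]. The other
   case is what makes [u0 >= 1] below. *)
have [small|big] := leP (k * e ^+ 2) 8.
  have := @expR_ge1Dx R (- ln (2 / eta)).
  rewrite expRN lnK ?posrE // invf_div => h; lra.
(* This [t] maximises [t * e / 2 - 2 * t ^+ 2], the gain per character in the final exponent. *)
pose t := e / 8; have t0 : 0 <= t <= 1 / 2 by rewrite /t; lra.
pose g l := Num.sg (hat f l).
have g1 l : `|g l| <= 1 by rewrite /g normr_sg; case: (_ != 0); rewrite ?lexx ?ler01.
pose P x := \sum_(l <- s) g l * chi l x.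
have H1 : k * (e * eta) <= mean (fun x => `|f x| * `|P x|).
  apply: le_trans (_ : mean (fun x => f x * P x) <= _); last first.
    by apply: ler_mean => x; rewrite -normrM ler_norm.
  rewrite (@eq_mean _ _ _ (fun x => \sum_(l <- s) g l * (f x * chi l x))); last first.
    by move=> x; rewrite /P big_distrr /=; apply: eq_bigr => l _; ring.
  rewrite mean_sum /k -sum1_size natr_sum big_distrl /=.
  rewrite big_seq [leRHS]big_seq; apply: ler_sum => l ls.
  rewrite mul1r meanZ -/(hat f l) /g -normrEsg; exact: hl.
(* Two Riesz products of opposite signs: [Q 1] handles the points where [P] is nonnegative, [Q (-1)]
   the others. *)
pose Q c x := riesz (fun l => t * (c * g l)) s x.
have H2 x : expR (t * `|P x|) <= expR (2 * k * t ^+ 2) * (Q 1 x + Q (-1) x).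
  have hc c : `|c| = 1 -> expR (t * (c * P x)) <= expR (2 * k * t ^+ 2) * Q c x.
    move=> c1.
    have := @riesz_ge t (fun l => c * g l) s x t0.
    have -> : \sum_(l <- s) c * g l * chi l x = c * P x.
      by rewrite /P big_distrr /=; apply: eq_bigr => l _; rewrite mulrA.
    move=> /(_ _)/(ler_wpM2l (expR_ge0 (2 * k * t ^+ 2))).
    rewrite -expRD -/(k); rewrite addrC subrK; apply.
    by move=> l; rewrite normrM c1 mul1r.
  have h1 := hc 1 (normr1 _); have h2 := hc (-1) (normrN1 _).
  have Q0 := expR_gt0 (t * (1 * P x)); have Q1 := expR_gt0 (t * (-1 * P x)).
  rewrite mulrDr; case: (ger0P (P x)) => _.
    by rewrite mul1r in h1 Q0; lra.
  by rewrite mulN1r in h2 Q1; lra.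
have H3 c : mean (Q c) = 1.
  by rewrite -(hat0 hp); case: (hat_riesz (fun l => t * (c * g l)) sV fs).
(* The exponential is bounded below by its tangent at [u0]. This [u0] makes the resulting lower
   bound [2 * eta * (1 - u0) + t * k * e * eta] equal to [eta]; since [1 - u0 <= 0], the upper bound
   on the mean of [|f|] can be used there. *)
pose u0 := 1 / 2 + t * k * e / 2.
have u01 : 1 <= u0 by rewrite /u0 /t; lra.
have H4 : mean (fun x => `|f x| * (1 + t * `|P x| - u0)) <= 2 * expR (2 * k * t ^+ 2 - u0).
  apply: le_trans (_ : mean (fun x => expR (2 * k * t ^+ 2 - u0) * (Q 1 x + Q (-1) x)) <= _).
    apply: ler_mean => x.
    apply: le_trans (_ : expR (t * `|P x| - u0) <= _).
      apply: le_trans (_ : `|f x| * expR (t * `|P x| - u0) <= _).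
        by rewrite ler_wpM2l // -addrA expR_ge1Dx.
      by rewrite ler_piMl ?expR_ge0.
    have := ler_wpM2r (expR_ge0 (- u0)) (H2 x).
    rewrite -expRD => /le_trans; apply.
    by rewrite expRD; lra.
  by rewrite meanZ meanD !H3; lra.
have H5 : eta <= 2 * expR (2 * k * t ^+ 2 - u0).
  apply: le_trans H4.
  rewrite (@eq_mean _ _ _ (fun x => (1 - u0) * `|f x| + t * (`|f x| * `|P x|))); last first.
    by move=> x; ring.
  rewrite meanD !meanZ.
  have := ler_wpM2l (proj1 (andP t0)) H1.
  have : (u0 - 1) * mean (fun x => `|f x|) <= (u0 - 1) * (2 * eta).
    by rewrite ler_wpM2l // subr_ge0.
  rewrite /u0; set m := mean _; set m' := mean _.
  by move=> h1 h2; lra.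
have H6 : eta / 2 <= expR (- (k * e ^+ 2 / 32)).
  have : expR (2 * k * t ^+ 2 - u0) <= expR (- (k * e ^+ 2 / 32)).
    by rewrite ler_expR /u0 /t; lra.
  by lra.
have : ln (eta / 2) <= - (k * e ^+ 2 / 32).
  rewrite -[leRHS]expRK ler_ln ?posrE ?expR_gt0 //; lra.
by rewrite -invf_div lnV ?posrE //; lra.
Qed.

(** Greedy choice: while some element of [L] lies outside the span, prepend it. The bound [k0]
    forces this to stop. *)
Lemma free_over_maximal (V L : {set T}) (k0 : nat) :
  (forall s, {subset s <= L} -> free_over V s -> (size s <= k0)%N) ->
  exists s, [/\ {subset s <= L}, free_over V s & L \subset extend V s].
Proof.
move=> bnd.
have : forall n, exists s, [/\ {subset s <= L}, free_over V s &
    (n <= size s)%N \/ L \subset extend V s].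
  elim=> [|n [s [sL fs [ns|?]]]]; first by exists [::]; split => //; left.
    have [LU|/subsetPn[l lL lU]] := boolP (L \subset extend V s).
      by exists s; split => //; right.
    exists (l :: s); split; last by left.
      by move=> x; rewrite in_cons => /orP[/eqP -> //|/sL].
    by rewrite /= lU.
  by exists s; split => //; right.
move=> /(_ k0.+1) [s [sL fs [ks|?]]]; last by exists s.
by have := bnd s sL fs; rewrite leqNgt ks.
Qed.

End RieszProducts.

(** * The increment step *)

Section Increment.
Variables (R : realType) (T : finZmodType) (p : T -> T -> bool).
Hypothesis hp : f2_pairing p.
Local Notation hat := (@hat R T p).
Local Notation proj := (@proj R T p).

Variable b : T -> R.
Hypothesis b01 : forall x, 0 <= b x <= 1.

(** The [eta] of the overview: for a subgroup [V], [varianceE] gives the form in terms of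
    [proj V b]. The spectral form used here compares it with the Fourier mass outside [V]. *)
Definition variance (V : {set T}) : R := mean b - \sum_(w in V) hat b w ^+ 2.

Lemma sum_hat_proj V f :
  \sum_w hat (proj V b) w * hat f w = \sum_(w in V) hat b w * hat f w.
Proof.
rewrite [RHS]big_mkcond /=; apply: eq_bigr => w _.
by rewrite hat_proj //; case: ifP; rewrite ?mul0r.
Qed.

Lemma mean_proj V : subgrp V -> mean (proj V b) = mean b.
Proof. by case=> V0 _; rewrite -(hat0 hp) hat_proj // V0 hat0. Qed.

Lemma mean_projM V : mean (fun x => proj V b x * b x) = \sum_(w in V) hat b w ^+ 2.
Proof. by rewrite (plancherel hp) sum_hat_proj. Qed.

Lemma mean_proj_sq V :
  mean (fun x => proj V b x * proj V b x) = \sum_(w in V) hat b w ^+ 2.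
Proof.
rewrite (plancherel hp) sum_hat_proj; apply: eq_bigr => w wV.
by rewrite hat_proj // wV.
Qed.

Lemma proj_itv V x : subgrp V -> 0 <= proj V b x <= 1.
Proof.
move=> sV; apply/andP; split.
  by apply: (proj_ge0 hp) => // y; case/andP: (b01 y).
by apply: (proj_le1 hp) => // y; case/andP: (b01 y).
Qed.

Lemma varianceE V : subgrp V ->
  variance V = mean (fun x => proj V b x * (1 - proj V b x)).
Proof.
move=> sV; rewrite /variance -(mean_proj sV) -mean_proj_sq -meanB.
by apply: eq_mean => x; ring.
Qed.

Lemma variance_le V : subgrp V -> variance V <= 1 / 4.
Proof.
move=> sV; rewrite varianceE // -[leRHS](mean_cst T).
by apply: ler_mean => x; have := proj_itv x sV; set y := proj V b x => h; have := sqr_ge0 (y - 1 / 2); lra.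
Qed.

(** [mean b * #|V|%:R] is the sum of the averages of [b] over the cosets of [perp V], one term in
    [[0, 1]] per coset, so subadditivity of [sawtooth] applies. *)
Lemma sawtooth_variance V : subgrp V ->
  sawtooth (mean b * #|V|%:R) <= #|V|%:R * variance V.
Proof.
move=> sV; rewrite varianceE // -(mean_proj sV) mulrC.
have [P [rep hrep]] := sum_cosets R hp sV.
have V0 := subgrp_card_gt0 R sV.
have N0 := card_gt0R R T; rewrite -(card_perp R hp sV) in N0.
have q0 : 0 < (#|perp p V|%:R : R) by rewrite (pmulr_rgt0 _ V0) in N0.
have E (F : T -> R) : (forall x y, x + y \in perp p V -> F x = F y) ->
    #|V|%:R * mean F = \sum_(C in P) F (rep C).
  move=> hF; rewrite /mean hrep // -(card_perp R hp sV) invfM.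
  by field; rewrite !gt_eqF.
have pc := @proj_coset R T p hp V b.
rewrite !E.
- by apply: sawtooth_sum => C; exact: proj_itv.
- by move=> x y h; rewrite (pc x y).
- by move=> x y h; rewrite (pc x y).
Qed.

(** For [x] and [y] in [[0, 1]], [|x - y| <= x + y - 2 * x * y]. With [b] and its projection, which
    have equal means, the right side averages to [2 * variance V]. *)
Lemma mean_norm_sub_proj V : subgrp V ->
  mean (fun x => `|b x - proj V b x|) <= 2 * variance V.
Proof.
move=> sV.
have -> : 2 * variance V =
    mean (fun x => b x + proj V b x - 2 * (proj V b x * b x)).
  by rewrite meanB meanD meanZ mean_projM mean_proj // /variance; ring.
apply: ler_mean => x; have := b01 x; have := proj_itv x sV => h1 h2.
by rewrite ler_norml; apply/andP; split; nra.
Qed.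

Lemma hat_sub_proj (V : {set T}) w : w \notin V -> hat (fun x => b x - proj V b x) w = hat b w.
Proof. by move=> /negbTE wV; rewrite hatB hat_proj // wV subr0. Qed.

Lemma hat_le_variance V w : subgrp V -> w \notin V -> `|hat b w| <= 2 * variance V.
Proof.
move=> sV wV; rewrite -(hat_sub_proj wV).
apply: le_trans (mean_norm_sub_proj sV); apply: le_trans (ler_norm_mean _) _.
by apply: ler_mean => x; rewrite normrM normr_chi mulr1.
Qed.

(** Plancherel; [eps] measures how far [b] is from being an indicator function. *)
Lemma energy_outside V (eps : R) : mean (fun x => b x * (1 - b x)) <= eps ->
  variance V - eps <= \sum_(w | w \notin V) hat b w ^+ 2.
Proof.
move=> he; have e : mean (fun x => b x * b x) = \sum_w hat b w ^+ 2.
  by rewrite (plancherel hp).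
have : mean (fun x => b x * (1 - b x)) = mean b - mean (fun x => b x * b x).
  by rewrite -meanB; apply: eq_mean => x; ring.
rewrite e (bigID (mem V)) /= /variance; move=> h; rewrite h in he; lra.
Qed.

(** If [2^-1 ^+ j * c < r <= 2 * 2^-1 ^+ j * c] with [1 <= j <= n], the active terms are those with
    [i >= j], and together with the tail they sum to exactly [2 * 2^-1 ^+ j]. A smaller [r] is
    covered by the tail alone. *)
Lemma dyadic_le (r c : R) n : 0 <= c -> r <= c ->
  r <= c * (\sum_(1 <= i < n.+1) (if 2^-1 ^+ i * c < r then 2^-1 ^+ i else 0) + 2^-1 ^+ n).
Proof.
move=> c0 rc; elim: n => [|n IH]; first by rewrite big_geq // add0r expr0 mulr1.
rewrite big_nat_recr //=; case: ifPn => [_|].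
  by rewrite -addrA exprS; apply: le_trans IH _; lra.
rewrite -leNgt => h; apply: le_trans h _; rewrite addr0 mulrDr mulrC lerDr.
rewrite mulr_ge0 //.
by apply: sumr_ge0 => i _; case: ifP => // _; rewrite exprn_ge0 // invr_ge0.
Qed.

Lemma sum_dyadic_nat n : \sum_(1 <= i < n.+1) (2^-1 : R) ^+ i * i%:R <= 2.
Proof.
suff -> : \sum_(1 <= i < n.+1) (2^-1 : R) ^+ i * i%:R = 2 - (n%:R + 2) * 2^-1 ^+ n.
  by rewrite lerBlDr lerDl mulr_ge0 ?exprn_ge0 ?invr_ge0 // addr_ge0.
elim: n => [|n IH]; first by rewrite big_geq // expr0; ring.
by rewrite big_nat_recr //= IH exprS -natr1; field.
Qed.

Definition level (V : {set T}) (i : nat) : {set T} :=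
  [set w | (w \notin V) && (2^-1 ^+ i * (2 * variance V) < `|hat b w|)]%SET.

(** Otherwise every level has mass at most [i / 16], and the dyadic decomposition bounds the energy
    outside [V] by [2 * variance V * (1 / 8 + 1 / 16)], which is less than the available
    [variance V / 2]. *)
Lemma level_mass V : subgrp V -> 0 < variance V ->
  mean (fun x => b x * (1 - b x)) <= variance V / 2 ->
  exists2 i, (0 < i)%N & i%:R / 16 <= \sum_(w in level V i) `|hat b w|.
Proof.
move=> sV v0 /energy_outside he.
have {}he := he V.
apply: contrapT => hno.
have hsmall i : (0 < i)%N -> \sum_(w in level V i) `|hat b w| <= i%:R / 16.
  by move=> i0; rewrite leNgt; apply/negP => h; apply: hno; exists i => //; exact: ltW.
pose S : R := \sum_(w | w \notin V) `|hat b w|.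
have S0 : 0 <= S by apply: sumr_ge0.
have [n hn] : exists n : nat, 2^-1 ^+ n * S <= 1 / 16.
  have [n hn] : exists n : nat, 16 * S <= n%:R.
    exists (Num.bound (16 * S)); apply/ltW/archi_boundP; by rewrite mulr_ge0.
  exists n; rewrite exprVn ler_pdivrMl ?exprn_gt0 //.
  have : (n%:R : R) <= 2 ^+ n by rewrite -natrX ler_nat ltnW // ltn_expl.
  by lra.
have key : \sum_(w | w \notin V) hat b w ^+ 2 <=
    2 * variance V * (\sum_(1 <= i < n.+1) 2^-1 ^+ i * (\sum_(w in level V i) `|hat b w|)
       + 2^-1 ^+ n * S).
  have -> : \sum_(1 <= i < n.+1) 2^-1 ^+ i * (\sum_(w in level V i) `|hat b w|) =
      \sum_(w | w \notin V) \sum_(1 <= i < n.+1)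
        (if 2^-1 ^+ i * (2 * variance V) < `|hat b w| then 2^-1 ^+ i else 0) * `|hat b w|.
    rewrite exchange_big /=; apply: eq_bigr => i _.
    rewrite big_distrr /= (eq_bigl (fun w => (w \notin V) &&
      (2^-1 ^+ i * (2 * variance V) < `|hat b w|))); last by move=> w; rewrite finset.in_set.
    by rewrite big_mkcondr /=; apply: eq_bigr => w _; case: ifP; rewrite ?mul0r.
  rewrite big_distrr -big_split big_distrr /=; apply: ler_sum => w wV.
  have v20 : 0 < 2 * variance V by rewrite mulr_gt0.
  have := dyadic_le n (ltW v20) (hat_le_variance sV wV).
  rewrite -big_distrl -mulrDl mulrA -real_normK ?num_real // expr2 /= => h.
  by rewrite ler_wpM2r.
have k2 : \sum_(1 <= i < n.+1) 2^-1 ^+ i * (\sum_(w in level V i) `|hat b w|) <= 1 / 8.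
  apply: le_trans (_ : (\sum_(1 <= i < n.+1) 2^-1 ^+ i * i%:R) / 16 <= _); last first.
    by have := sum_dyadic_nat n; lra.
  rewrite big_distrl /= big_nat [leRHS]big_nat; apply: ler_sum => i /andP[i0 _].
  by rewrite -mulrA ler_wpM2l ?exprn_ge0 ?invr_ge0 // hsmall.
move: k2 key; set X := \sum_(1 <= i < _) _ => k2 key.
have : 2 * variance V * (X + 2^-1 ^+ n * S) <= 2 * variance V * (1/8 + 1/16).
  by rewrite ler_pM2l ?mulr_gt0 // lerD.
by lra.
Qed.

(** Adjoin to [V] a maximal free family from the level given by [level_mass]. The whole level then
    lies in the new subgroup, and Chang's inequality bounds the size of the family. *)
Lemma increment V : subgrp V -> 0 < variance V ->
  mean (fun x => b x * (1 - b x)) <= variance V / 2 ->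
  exists (V' : {set T}) (k i : nat),
    [/\ subgrp V' /\ V \subset V', #|V'| = (#|V| * 2 ^ k)%N, (0 < i)%N,
        k%:R <= 8 * 4 ^+ i * ln (2 / variance V) &
        \sum_(w in V) `|hat b w| + i%:R / 16 <= \sum_(w in V') `|hat b w|].
Proof.
move=> sV v0 he; have [i i0 hi] := level_mass sV v0 he.
have v1 := variance_le sV.
have x0 : 0 < 2^-1 ^+ i :> R by rewrite exprn_gt0 // invr_gt0.
have x1 : 2^-1 ^+ i <= 1 :> R by apply: exprn_ile1; lra.
have bnd s : {subset s <= level V i} -> free_over V s ->
    (size s)%:R <= 8 * 4 ^+ i * ln (2 / variance V).
  move=> sL fs.
  have sN l : l \in s -> l \notin V by move=> /sL; rewrite finset.in_set => /andP[].
  (* The threshold of [level V i] is [e * eta] with [e = 2 * 2^-1 ^+ i] and [eta = variance V]. *)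
  have := @chang R T p hp V (fun x => b x - proj V b x) (variance V) (2 * 2^-1 ^+ i) s
    sV fs.
  have -> : (2 * 2^-1 ^+ i) ^+ 2 = 4 / 4 ^+ i :> R.
    rewrite exprMn -exprM mulnC exprM -exprVn.
    by congr (_ * _ ^+ _); field.
  move=> h; have {h} : (size s)%:R * (4 / 4 ^+ i) <= 32 * ln (2 / variance V).
    apply: h.
    - move=> x; have := b01 x; have := proj_itv x sV => h1 h2.
      by rewrite ler_norml; apply/andP; split; lra.
    - exact: mean_norm_sub_proj.
    - by rewrite v0.
    - by lra.
    - move=> l ls; rewrite hat_sub_proj ?sN //.
      by have := sL _ ls; rewrite finset.in_set => /andP[_ /ltW]; rewrite mulrCA mulrA.
  rewrite mulrA ler_pdivrMr ?exprn_gt0 //; lra.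
have [n hn] : exists n : nat, 8 * 4 ^+ i * ln (2 / variance V) <= n%:R.
  set z := 8 * _ * _; exists (Num.bound `|z|).
  by apply: le_trans (ler_norm _) _; exact/ltW/archi_boundP.
have [|s [sL fs LU]] := @free_over_maximal T V (level V i) n.
  by move=> s sL fs; rewrite -(ler_nat R); apply: le_trans hn; exact: bnd.
exists (extend V s), (size s), i; split => //.
- by split; [exact: (extend_subgrp hp)|exact: sub_extend].
- exact: (card_extend hp).
- exact: bnd.
rewrite (bigID (mem V) (mem (extend V s))) /=; apply: lerD.
  rewrite le_eqVlt; apply/orP; left; apply/eqP; apply: eq_bigl => w.
  case wV: (w \in V); rewrite ?andbF // andbT.
  by rewrite (fintype.subsetP (sub_extend V s)).
apply: le_trans hi _; rewrite [leRHS]big_mkcond [leLHS]big_mkcond /=.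
apply: ler_sum => w _; case: ifP => wL; last by case: ifP.
rewrite (fintype.subsetP LU) //=; by move: wL; rewrite finset.in_set => /andP[-> _].
Qed.

(** The tolerance [delta / (2 * M)] serves every subgroup met: [#|V|%:R <= M] gives
    [variance V >= delta / M], so [increment] applies as long as [V] is this small. *)
Lemma finite_loglog (delta M : R) : 0 < delta -> 1 < M ->
  mean (fun x => b x * (1 - b x)) <= delta / (2 * M) ->
  (forall V : {set T}, subgrp V -> #|V|%:R <= M ->
     delta <= sawtooth (mean b * #|V|%:R)) ->
  (560 + `|ln (ln (2 / delta))| / delta)^-1 * ln (ln M) <= \sum_w `|hat b w|.
Proof.
move=> d0 M1 he hV.
(* [560] is [16 * 35]: a gain of [i / 16] has to pay for [ln (36 ^+ i)], and [ln 36 <= 35]. *)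
have [K [KE K0]] : exists K : R, 560 = K /\ 0 < K by exists 560; rewrite ltr0n.
rewrite KE.
have M0 : 0 < M by lra.
have ln_le1D (x : R) : 0 < x -> ln x <= x - 1.
  by move=> x0; have := @expR_ge1Dx R (ln x); rewrite lnK ?posrE //; lra.
have hvar V : subgrp V -> #|V|%:R <= M -> delta / #|V|%:R <= variance V.
  move=> sV VM; rewrite ler_pdivrMr ?subgrp_card_gt0 // mulrC.
  exact: le_trans (hV V sV VM) (sawtooth_variance sV).
have s0 : subgrp [set (0 : T)]%SET.
  by split=> [|x y /set1P -> /set1P ->]; rewrite ?addr0 set11.
have c0 : #|[set (0 : T)]%SET| = 1%N by rewrite cards1.
have hv0 := hvar _ s0; rewrite c0 invr1 mulr1 in hv0.
have {}hv0 := le_trans (hv0 (ltW M1)) (variance_le s0).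
set L := ln (2 / delta).
have L1 : 7 / 8 <= L.
  have := @expR_ge1Dx R (- L); rewrite expRN /L lnK ?posrE ?divr_gt0 // invf_div; lra.
set S := \sum_w _.
(* Leads to [delta <= S], which at the end absorbs the additive [ln L] into a multiple of [S]; hence
   the term divided by [delta] in the constant. *)
have md : delta <= mean b.
  have := hV _ s0; rewrite c0 mulr1 => /(_ (ltW M1)).
  have m01 : 0 <= mean b <= 1.
    apply/andP; split; first by rewrite -[leLHS](mean_cst T); apply: ler_mean => x; case/andP: (b01 x).
    by rewrite -[leRHS](mean_cst T); apply: ler_mean => x; case/andP: (b01 x).
  by rewrite sawtooth_itv //; have := sqr_ge0 (mean b); lra.
have Sd : delta <= S.
  apply: le_trans md _; rewrite -(hat0 hp) /S (bigD1 0) //=.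
  apply: le_trans (ler_norm _) _; rewrite lerDl; exact: sumr_ge0.
have massS V : \sum_(w in V) `|hat b w| <= S.
  by rewrite /S [leRHS](bigID (mem V)) /= lerDl; exact: sumr_ge0.
(* Each step gains [i / 16] of l1-mass while [d + L] grows at most by the factor
   [36 ^+ i], so this inequality is preserved. *)
pose I V := `[< subgrp V /\ exists d, #|V| = (2 ^ d)%N /\
  ln (d%:R + L) <= ln L + K * \sum_(w in V) `|hat b w| >].
have I0 : I [set (0 : T)]%SET.
  apply/asboolP; split=> //; exists 0%N; rewrite c0 expn0 add0r; split=> //.
  by rewrite lerDl mulr_ge0 ?(ltW K0) ?sumr_ge0.
(* A largest [V] satisfying the invariant replaces the iteration. If [#|V|%:R <= M], the increment
   yields another such subgroup, strictly larger because its l1-mass is strictly larger. *)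
case: (arg_maxnP (fun V : {set T} => #|V|) I0) => V /asboolP[sV [d [cV hd]]] Vmax.
have [VM|MV] := leP #|V|%:R M.
  have V0 := subgrp_card_gt0 R sV.
  have hv := hvar V sV VM.
  have v0 : 0 < variance V by apply: lt_le_trans hv; rewrite divr_gt0.
  have he2 : mean (fun x => b x * (1 - b x)) <= variance V / 2.
    apply: le_trans he _; rewrite invfM mulrCA mulrC ler_pM2r ?invr_gt0 //.
    apply: le_trans hv; rewrite ler_pM2l // lef_pV2 ?posrE //.
  have [V' [k [i [[sV' VV'] cV' i0 hk hS]]]] := increment sV v0 he2.
  have dL : 0 < d%:R + L by rewrite ltr_wpDl //; lra.
  have lnv : ln (2 / variance V) <= d%:R + L.
    apply: le_trans (_ : ln (2 ^+ d * (2 / delta)) <= _).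
      rewrite ler_ln ?posrE ?mulr_gt0 ?exprn_gt0 ?invr_gt0 //.
      rewrite mulrCA ler_pM2l // -[leRHS]invrK lef_pV2 ?posrE ?invr_gt0 ?divr_gt0 ?exprn_gt0 //.
      by rewrite invf_div; move: hv; rewrite cV natrX.
    rewrite lnM ?posrE ?divr_gt0 ?exprn_gt0 // lerD2r lnXn // -[leRHS]mulr_natr mul1r -[leLHS]mulr_natr.
    rewrite ler_piMl //; have := ln_le1D 2; lra.
  have : I V'.
    apply/asboolP; split=> //; exists (d + k)%N; split.
      by rewrite cV' cV expnD.
    (* The bound on [k] gives the factor [1 + 8 * 4 ^+ i], at most [9 * 4 ^+ i], hence at most
       [36 ^+ i] since [i >= 1]. *)
    have h36 : (d + k)%:R + L <= (d%:R + L) * 36 ^+ i.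
      have h4 : 1 + 8 * 4 ^+ i <= 36 ^+ i :> R.
        have -> : 36 = 9 * 4 :> R by ring.
        rewrite exprMn.
        have : 1 <= 4 ^+ i :> R by rewrite exprn_ege1 //; lra.
        have : 9 <= 9 ^+ i :> R by rewrite -{1}(expr1 9) ler_weXn2l //; lra.
        move=> h9 h1; apply: le_trans (_ : 9 * 4 ^+ i <= _); first lra.
        by rewrite ler_wpM2r // exprn_ge0.
      apply: le_trans (_ : (d%:R + L) * (1 + 8 * 4 ^+ i) <= _); last by rewrite ler_pM2l.
      have : k%:R <= 8 * 4 ^+ i * (d%:R + L).
        by apply: le_trans hk _; rewrite ler_wpM2l // mulr_ge0 // exprn_ge0.
      by rewrite natrD; lra.
    apply: le_trans (_ : ln ((d%:R + L) * 36 ^+ i) <= _).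
      rewrite ler_ln ?posrE ?mulr_gt0 ?exprn_gt0 //.
      by rewrite ltr_wpDl //; lra.
    rewrite lnM ?posrE ?exprn_gt0 // lnXn // -[X in _ + X]mulr_natr.
    have /(ler_wpM2r (ler0n R i)) : ln 36 <= 35 :> R by have := ln_le1D 36; lra.
    by move: hS hd; rewrite -KE; lra.
  move=> /Vmax; rewrite /geq /= cV' leqNgt => /negP; case.
  rewrite -[X in (X < _)%N]muln1 ltn_pmul2l; last by rewrite -(ltr_nat R).
  rewrite -[1%N](expn0 2) ltn_exp2l //.
  case: (posnP k) => // k0; exfalso.
  have VE : V = V' by apply/eqP; rewrite eqEcard VV' cV' k0 expn0 muln1 leqnn.
  have : 0 < i%:R :> R by rewrite ltr0n.
  by move: hS; rewrite -VE; lra.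
have lnlnM : ln (ln M) <= ln (d%:R + L).
  rewrite ler_ln ?posrE ?ln_gt0 //; last by rewrite ltr_wpDl //; lra.
  apply: le_trans (_ : ln (2 ^+ d) <= _).
    by rewrite ler_ln ?posrE ?exprn_gt0 // -natrX -cV ltW.
  rewrite lnXn // -[leLHS]mulr_natr.
  have /(ler_wpM2r (ler0n R d)) : ln 2 <= 1 :> R by have := ln_le1D 2; lra.
  by lra.
have D0 : 0 < K + `|ln L| / delta by rewrite ltr_pwDl // divr_ge0 ?(ltW d0).
rewrite ler_pdivrMl // mulrDl.
apply: le_trans lnlnM _; apply: le_trans hd _; rewrite addrC lerD //.
  by rewrite ler_wpM2l ?(ltW K0).
apply: le_trans (ler_norm _) _; rewrite mulrAC ler_pdivlMr // ler_wpM2l //.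
Qed.

End Increment.

(** * Bogolyubov's theorem and open subgroups *)

Section Bogolyubov.
Variables (R : realType) (T : finZmodType) (p : T -> T -> bool).
Hypothesis hp : f2_pairing p.
Local Notation chi := (chi R p).
Local Notation hat := (@hat R T p).

Definition conv (f g : T -> R) (x : T) : R := mean (fun y => f y * g (x + y)).

Lemma hat_conv f g w : hat (conv f g) w = hat f w * hat g w.
Proof.
rewrite {1}/hat (@eq_mean _ _ _
  (fun x => mean (fun y => f y * chi w y * (g (x + y) * chi w (x + y))))).
  rewrite {1}/mean; under eq_bigr do rewrite /mean.
  rewrite -big_distrr exchange_big /=.
  under eq_bigr => y _ do rewrite -big_distrr (sum_shift (fun z => g z * chi w z)).
  by rewrite -big_distrl /= /hat /mean; ring.
move=> x; rewrite /conv mulrC -meanZ; apply: eq_mean => y.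
by rewrite (chiDr R hp); have := chiK R p w y => h; rewrite -[LHS]mulr1 -{1}h; ring.
Qed.

Lemma mean_neq0 (f : T -> R) : mean f != 0 -> exists x, f x != 0.
Proof.
move=> h; apply: contrapT => hno; move: h; rewrite /mean big1 ?mulr0 ?eqxx // => x _.
by apply/eqP; apply: contrapT => /negP fx; apply: hno; exists x.
Qed.

(** [Sp] collects the frequencies with [hat f w ^+ 2 >= sg ^+ 3 / 2], where [f] is the indicator of
    [S] and [sg] its mean. At a point [t] annihilated by [Sp], these contribute at least [sg ^+ 4]
    to the fourfold convolution of [f], the rest at most [sg ^+ 4 / 2] in absolute value, so [t] is
    a sum of four elements of [S]. Plancherel bounds [#|Sp|]. *)
Lemma bogolyubov (S : {set T}) (m : nat) : (#|T| <= m * #|S|)%N ->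
  exists2 Sp : {set T}, (#|Sp| <= 2 * m ^ 2)%N &
    forall t, (forall w, w \in Sp -> p w t = false) ->
      exists a b c d, [/\ a \in S, b \in S, c \in S, d \in S & t = a + b + (c + d)].
Proof.
move=> hS; pose f x : R := (x \in S)%:R; pose sg := mean f.
have N0 := card_gt0R R T.
have sgE : sg = #|S|%:R / #|T|%:R.
  by rewrite /sg /mean mulrC /f -natr_sum -big_mkcond sum1_card.
have sg1 : 1 <= m%:R * sg.
  by rewrite sgE mulrA ler_pdivlMr // mul1r -natrM ler_nat.
have m0 : 0 <= m%:R :> R by [].
have sg0 : 0 < sg.
  rewrite ltNge; apply/negP => h; have := mulr_ge0_le0 m0 h; lra.
have sum2 : \sum_w hat f w ^+ 2 = sg.
  rewrite -(plancherel hp); apply: eq_mean => x.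
  by rewrite /f; case: (x \in S); rewrite ?mulr1 ?mulr0.
have sgle1 : sg <= 1.
  rewrite -[leRHS](mean_cst T); apply: ler_mean => x.
  by rewrite /f; case: (x \in S); rewrite ?lexx ?ler01.
exists [set w | sg ^+ 3 / 2 <= hat f w ^+ 2]%SET.
  set Sp := [set w | _]%SET.
  have h : #|Sp|%:R * (sg ^+ 3 / 2) <= sg.
    rewrite -[X in _ <= X]sum2 [leRHS](bigID (mem Sp)) /= -[leLHS]addr0 lerD //.
      rewrite mulr_natl -sumr_const; apply: ler_sum => w.
      by rewrite finset.in_set.
    by apply: sumr_ge0 => w _; rewrite sqr_ge0.
  rewrite -(ler_nat R) natrM natrX.
  have h2 : #|Sp|%:R * sg ^+ 2 <= 2.
    rewrite -(ler_pM2r sg0); have -> : #|Sp|%:R * sg ^+ 2 * sg = 2 * (#|Sp|%:R * (sg ^+ 3 / 2)) by field.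
    by rewrite ler_pM2l.
  have h3 : 1 <= (m%:R * sg) ^+ 2 by rewrite exprn_ege1.
  apply: le_trans (_ : #|Sp|%:R * (m%:R * sg) ^+ 2 <= _).
    by rewrite ler_peMr.
  have -> : #|Sp|%:R * (m%:R * sg) ^+ 2 = #|Sp|%:R * sg ^+ 2 * m%:R ^+ 2 by ring.
  by rewrite ler_wpM2r ?sqr_ge0.
move=> t ht.
have fE x : f x != 0 -> x \in S by rewrite /f; case: (x \in S); rewrite ?eqxx.
have key : 0 < conv (conv f f) (conv f f) t.
  rewrite (fourier_inversion hp (conv _ _) t).
  rewrite (eq_bigr (fun w => hat f w ^+ 4 * chi w t)); last first.
    by move=> w _; rewrite !hat_conv; ring.
  rewrite (bigID (fun w => sg ^+ 3 / 2 <= hat f w ^+ 2)) /=.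
  have h1 : sg ^+ 4 <= \sum_(w | sg ^+ 3 / 2 <= hat f w ^+ 2) hat f w ^+ 4 * chi w t.
    rewrite (eq_bigr (fun w => hat f w ^+ 4)); last first.
      by move=> w hw; rewrite chi_eq1 ?mulr1 // ht // finset.in_set.
    rewrite (bigD1 0) /=; last first.
      rewrite (hat0 hp) -/sg; have -> : sg ^+ 3 = sg * sg ^+ 2 by ring.
      have := sqr_ge0 sg; nra.
    rewrite (hat0 hp) lerDl sumr_ge0 // => w _.
    by rewrite -[4%N]/(2 * 2)%N exprM sqr_ge0.
  have h2 : `|\sum_(w | ~~ (sg ^+ 3 / 2 <= hat f w ^+ 2)) hat f w ^+ 4 * chi w t| <= sg ^+ 4 / 2.
    apply: le_trans (ler_norm_sum _ _ _) _.
    apply: le_trans (_ : \sum_(w | ~~ (sg ^+ 3 / 2 <= hat f w ^+ 2)) (sg ^+ 3 / 2) * hat f w ^+ 2 <= _).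
      apply: ler_sum => w; rewrite -ltNge => hw.
      rewrite normrM normr_chi mulr1 -[4%N]/(2 + 2)%N exprD normrM.
      by rewrite ger0_norm ?sqr_ge0 // ler_wpM2r ?sqr_ge0 // ltW.
    rewrite -big_distrr /=.
    have -> : sg ^+ 4 / 2 = sg ^+ 3 / 2 * sg by field.
    rewrite ler_wpM2l //; first by rewrite divr_ge0 // exprn_ge0 // ltW.
    rewrite -[X in _ <= X]sum2 [leRHS](bigID (fun w => sg ^+ 3 / 2 <= hat f w ^+ 2)) /= lerDr.
    by apply: sumr_ge0 => w _; rewrite sqr_ge0.
  have h3 : 0 < sg ^+ 4 by rewrite exprn_gt0.
  by move: h2; rewrite ler_norml => /andP[h2 _]; lra.
have [y] := mean_neq0 (lt0r_neq0 key).
rewrite mulf_eq0 negb_or => /andP[/mean_neq0[a] + /mean_neq0[c]].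
rewrite !mulf_eq0 !negb_or => /andP[/fE aS /fE bS] /andP[/fE cS /fE dS].
exists a, (y + a), c, (t + y + c); split => //.
have xx := addxx hp.
have K (z u : T) : z + (u + z) = u by rewrite addrCA xx addr0.
by rewrite !K.
Qed.

End Bogolyubov.

(* Makes products of [finZmodType]s canonical [finZmodType]s. *)
HB.saturate prod.

(** The last clause is injectivity modulo [H]. With [H] trivial this parametrises a finite subspace
    of [G]; when every coset of [H] is reached, [T] is a model of the quotient. *)
Definition f2_embedding (G : zmodType) (H : set G) (T : finZmodType)
    (p : T -> T -> bool) (psi : T -> G) : Prop :=
  [/\ f2_pairing p, forall s t, psi (s + t) = psi s + psi t &
      forall t, H (psi t) -> t = 0].

Definition subgroup (G : zmodType) (H : set G) : Prop :=
  H 0 /\ forall x y, H x -> H y -> H (x + y).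

(** * Bogolyubov's theorem in groups of exponent two *)

Section ExponentTwo.
Variable G : zmodType.
Hypothesis G2 : forall x : G, x + x = 0.

Lemma addxxK2 (x y z : G) : x + y + (y + z) = x + z.
Proof. by rewrite addrA -(addrA x) G2 addr0. Qed.

(** Induction on [l]: an element not yet reached modulo [H] adds a factor [bool], orthogonal to the
    previous ones. *)
Lemma embed_seq (H : set G) (l : seq G) : subgroup H ->
  exists (T : finZmodType) (p : T -> T -> bool) (psi : T -> G),
    f2_embedding H p psi /\ forall x, x \in l -> exists t, H (x + psi t).
Proof.
move=> [H0 HD]; elim: l => [|x l [T [p [psi [[hp psiD psiH] hl]]]]].
  exists 'I_1, (fun _ _ => false), (fun=> 0); split=> //; split.
  - by split=> // y; rewrite ord1 eqxx.
  - by move=> _ _; rewrite addr0.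
  - by move=> t _; exact: ord1.
have [[t ht]|hx] := pselect (exists t, H (x + psi t)).
  exists T, p, psi; split=> // y; rewrite in_cons => /orP[/eqP ->|/hl//].
  by exists t.
have psi0 : psi 0 = 0.
  by apply: (addrI (psi 0)); rewrite -psiD !addr0.
exists (T * bool)%type, (fun w v => p w.1 v.1 (+) (w.2 && v.2)),
  (fun v => psi v.1 + (if v.2 then x else 0)).
have [pC pD pn] := hp.
split; last first.
  move=> y; rewrite in_cons => /orP[/eqP ->|/hl [t ht]].
    by exists (0, true); rewrite /= psi0 add0r G2.
  by exists (t, false); rewrite /= addr0.
split; first split.
- by move=> v w; rewrite pC andbC.
- move=> [w e] [v f] [u g] /=; rewrite pD.
  by case: e f g (p w v) (p w u) => [] [] [] [] [].
- move=> [v f] vf0 /=.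
  have [f1|f0] := boolP f.
    exists (0, true) => /=.
    by have := pD v 0 0; rewrite addr0 (pC v 0); case: (p 0 v).
  have [w pw] : exists w, p w v.
    apply: pn; apply: contra_neq vf0 => ->; by case: f f0.
  by exists (w, false); rewrite /= pw.
- move=> [v f] [u g] /=; rewrite psiD addrACA; congr (_ + _).
  by case: f g => [] [] /=; rewrite ?addr0 ?add0r ?G2.
- move=> [v f] /=; case: f => /= [h|]; last by rewrite addr0 => /psiH ->.
  by exfalso; apply: hx; exists v; rewrite addrC.
Qed.

(** Apply [bogolyubov] in the span of [l], where some translate of [C] has density at least
    [1 / size a]. The bounded index is phrased as a pigeonhole whose size does not depend on [l], so
    that it survives the passage to a limit. *)
Lemma finite_bogolyubov (R : realType) (C : set G) (a l : seq G) :
  (forall x, exists2 y, y \in a & C (x + y)) ->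
  exists W : set G, [/\ subgroup W,
    forall x, W x -> exists c1 c2 c3 c4,
      [/\ C c1, C c2, C c3, C c4 & x = c1 + c2 + (c3 + c4)] &
    forall x : 'I_(2 ^ (2 * size a ^ 2)).+1 -> G, (forall i, x i \in l) ->
      exists i j, i != j /\ W (x i + x j)].
Proof.
move=> cov.
have s0 : subgroup [set (0 : G)] by split=> // x y -> ->; rewrite addr0.
have [T [p [psi [[hp psiD psiH] hl]]]] := embed_seq l s0.
pose S y : {set T} := [set t | `[< C (psi t + y) >]]%SET.
have [y ya hS] : exists2 y, y \in a & (#|T| <= size a * #|S y|)%N.
  apply: contrapT => hno.
  have hlt y : y \in a -> (size a * #|S y| < #|T|)%N.
    by move=> ya; rewrite ltnNge; apply/negP => h; apply: hno; exists y.
  have sz : (0 < size a)%N by have [y] := cov 0; case: (a).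
  have : (#|T| <= \sum_(y <- a) #|S y|)%N.
    rewrite -sum1_card.
    under [X in (_ <= X)%N]eq_bigr do rewrite -sum1_card big_mkcond /=.
    rewrite exchange_big /=; apply: leq_sum => t _.
    have [y ya ty] := cov (psi t).
    rewrite (big_rem y) //= finset.in_set; by rewrite asboolT.
  rewrite leqNgt => /negP; apply.
  rewrite -(ltn_pmul2l sz) big_distrr /=.
  apply: leq_ltn_trans (_ : (\sum_(y <- a) #|T|.-1 < _)%N).
    rewrite big_seq [X in (_ <= X)%N]big_seq; apply: leq_sum => y /hlt.
    by case: #|T|.
  rewrite big_const_seq count_predT iter_addn_0 mulnC ltn_pmul2l //.
  by rewrite ltn_predL; apply/card_gt0P; exists 0.
have [Sp cSp hSp] := bogolyubov R hp hS.
have [_ pD _] := hp.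
have psi0 : psi 0 = 0 by apply: (addrI (psi 0)); rewrite -psiD !addr0.
exists [set x | exists2 t, x = psi t & forall w, w \in Sp -> p w t = false]; split.
- split=> [|_ _ [s -> hs] [t -> ht]].
    by exists 0 => // w _; have := pD w 0 0; rewrite addr0; case: (p w 0).
  by exists (s + t) => [|w wS]; rewrite ?psiD // pD hs // ht.
- move=> _ [t -> /hSp [c1 [c2 [c3 [c4 [h1 h2 h3 h4 ->]]]]]].
  (* The translation [y] occurs four times in the sum and cancels. *)
  have hC c : c \in S y -> C (psi c + y) by rewrite finset.in_set => /asboolP.
  exists (psi c1 + y), (psi c2 + y), (psi c3 + y), (psi c4 + y).
  split; [exact: hC|exact: hC|exact: hC|exact: hC|].
  by rewrite !psiD ![psi _ + y + _]addrACA G2 !addr0.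
- move=> x xl.
  have /boolp.choice [u hu] : forall i, exists t, x i = psi t.
    move=> i; have [t /= ht] := hl _ (xl i); exists t.
    by apply: (addIr (psi t)); rewrite G2; exact: ht.
  (* Two indices with the same [F] differ by an element that all of [Sp] annihilates; there are at
     most [2 ^ #|Sp|] values of [F]. *)
  pose F i : {set T} := [set w in Sp | p w (u i)]%SET.
  have /injectivePn [i [j ij Fij]] : ~~ injectiveb F.
    apply/negP => /injectiveP injF.
    have : (#|F @: 'I_(2 ^ (2 * size a ^ 2)).+1| <= #|powerset Sp|)%N.
      apply: subset_leq_card; apply/fintype.subsetP => _ /imsetP[i _ ->].
      by rewrite powersetE; apply/fintype.subsetP => w; rewrite finset.in_set => /andP[].
    rewrite card_imset // card_ord card_powerset leqNgt => /negP; apply.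
    by rewrite ltnS leq_exp2l.
  exists i, j; split=> //; exists (u i + u j); first by rewrite psiD -!hu.
  move=> w wS; rewrite pD.
  have := congr1 (fun A : {set T} => w \in A) Fij.
  by rewrite !finset.in_set wS /= => ->; rewrite addbb.
Qed.

(* [W] is the limit, along an ultrafilter refining inclusion of finite lists, of
   the subgroups that [finite_bogolyubov] attaches to the finite lists of [G]. *)
Lemma bogolyubov_limit (R : realType) (C : set G) (a : seq G) :
  (forall x, exists2 y, y \in a & C (x + y)) ->
  exists W : set G, [/\ subgroup W,
    forall x, W x -> exists c1 c2 c3 c4,
      [/\ C c1, C c2, C c3, C c4 & x = c1 + c2 + (c3 + c4)] &
    forall x : 'I_(2 ^ (2 * size a ^ 2)).+1 -> G,
      exists i j, i != j /\ W (x i + x j)].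
Proof.
move=> cov.
have /boolp.choice [W hW] := fun l => @finite_bogolyubov R C a l cov.
pose F : set_system (seq G) :=
  [set P : set (seq G) | exists l0 : seq G, forall l : seq G, {subset l0 <= l} -> P l].
have FF : ProperFilter F.
  split; first by move=> [l0 /(_ l0)]; apply.
  split; first by exists [::].
    move=> P Q [l1 h1] [l2 h2]; exists (l1 ++ l2) => l hl; split.
      by apply: h1 => x xl; apply: hl; rewrite mem_cat xl.
    by apply: h2 => x xl; apply: hl; rewrite mem_cat xl orbT.
  by move=> P Q PQ [l0 h]; exists l0 => l /h /PQ.
have [U [UU FU]] := ultraFilterLemma FF.
exists [set x | U [set l | W l x]]; split.
- split=> [|x y hx hy].
    by apply: filterS filterT => l _; case: (hW l) => [[]].
  by apply: filterS2 hx hy => l; case: (hW l) => [[_ +] _ _]; apply.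
- move=> x /(@filter_ex _ _ _) [l]; case: (hW l) => _ + _; exact.
(* If no pair works, the ultrafilter contains the failure of each of the finitely many pairs, hence
   of all at once. A list with this property that also contains every [x i] contradicts the
   pigeonhole for that list. *)
move=> x; apply: contrapT => hno.
have h i j : i != j -> U [set l | ~ W l (x i + x j)].
  move=> ij; have [h|//] := in_ultra_setVsetC [set l | W l (x i + x j)] UU.
  by exfalso; apply: hno; exists i, j.
have hall : U [set l | forall i j, i != j -> ~ W l (x i + x j)].
  apply: filter_forall => i; apply: filter_forall => j.
  have [ij|ij] := eqVneq i j; first by apply: nearW.
  by apply: filterS (h i j ij) => l + _.
have hin : U [set l : seq G | forall i, x i \in l].
  apply: FU; exists [seq x i | i <- enum 'I_(2 ^ (2 * size a ^ 2)).+1] => l hl i.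
  by apply: hl; apply: map_f; rewrite mem_enum.
have [l [h1 h2]] := filter_ex (filterI hall hin).
case: (hW l) => _ _ /(_ x h2) [i [j [ij]]]; exact: h1.
Qed.

(** Grow a list of pairwise incongruent elements; it becomes complete before reaching length [n]. *)
Lemma finite_index_reps (W : set G) n : subgroup W ->
  (forall x : 'I_n -> G, exists i j, i != j /\ W (x i + x j)) ->
  exists l : seq G, forall x, exists2 y, y \in l & W (x + y).
Proof.
move=> sW hn.
have H : forall m, (exists l : seq G, forall x, exists2 y, y \in l & W (x + y)) \/
    exists l : seq G, size l = m /\
      forall i j, (i < j < m)%N -> ~ W (nth 0 l i + nth 0 l j).
  elim=> [|m [?|[l [szl hl]]]]; [by right; exists [::]; split=> // i j; rewrite andbF|by left|].
  have [hc|hc] := pselect (forall x, exists2 y, y \in l & W (x + y)).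
    by left; exists l.
  have /existsNP [x hx] := hc; right.
  exists (rcons l x); rewrite size_rcons szl; split=> // i j /andP[ij].
  rewrite ltnS leq_eqVlt => /orP[/eqP jm|jm].
    rewrite !nth_rcons szl jm ltnn eqxx -jm ij => h; apply: hx.
    exists (nth 0 l i); first by rewrite mem_nth // szl -jm.
    by rewrite addrC.
  rewrite !nth_rcons szl jm (ltn_trans ij jm); apply: hl.
  by rewrite ij jm.
have [//|[l [szl hl]]] := H n.
have [i [j [ij h]]] := hn (fun i => nth 0 l i).
move: ij; rewrite neq_ltn => /orP[ij|ij]; exfalso.
  by apply: (hl i j) => //; rewrite ij ltn_ord.
by apply: (hl j i) => //; rewrite ?ij ?ltn_ord // addrC.
Qed.

End ExponentTwo.

(** * Open subgroups and finite quotients of a compact group of exponent two *)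

Section OpenSubgroups.
Variables (R : realType) (G : topologicalZmodType).
Hypothesis G2 : forall x : G, x + x = 0.
Hypothesis Gc : compact [set: G].

Lemma continuous_addr (y : G) : continuous (fun z : G => z + y).
Proof.
move=> z; apply: (@continuous_comp _ _ _ (fun z => (z, y)) (fun x : G * G => x.1 + x.2)).
  by apply: cvg_pair => /=; [exact: cvg_id|exact: cvg_cst].
exact: add_continuous.
Qed.

Lemma compact_seq_cover (K : set G) (f : G -> set G) : compact K ->
  (forall x, K x -> open (f x)) -> (forall x, K x -> f x x) ->
  exists2 s : seq G, (forall y, y \in s -> K y) &
    forall x, K x -> exists2 y, y \in s & f y x.
Proof.
move=> cK of_ fx.
have : @cover_compact (Gp G) K by rewrite -compact_cover; exact: cK.
move=> /(_ G K f) []; first exact: of_.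
  by move=> x Kx; exists x => //; exact: fx.
move=> D DK hD; exists (finmap.enum_fset D) => [y /DK|x /hD [y yD]].
  by rewrite inE.
by exists y.
Qed.

Lemma nbhs_shift (C : set G) (x y : G) : nbhs (x + y) C -> nbhs x [set z | C (z + y)].
Proof. exact: continuous_addr. Qed.

Lemma open_shift (C : set G) (y : G) : open C -> open [set z | C (z + y)].
Proof. by move=> oC; apply: open_comp => // z _; exact: continuous_addr. Qed.

Lemma closed_shift (C : set G) (y : G) : closed C -> closed [set z | C (z + y)].
Proof. by move=> cC; apply: closed_comp => // z _; exact: continuous_addr. Qed.

Lemma nbhs0_half (U : set G) : nbhs 0 U ->
  exists2 V : set G, nbhs 0 V & forall x y, V x -> V y -> U (x + y).
Proof.
move=> U0; have := @add_continuous G (0, 0) U.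
rewrite /= addr0 => /(_ U0) [[A B] /= [A0 B0] AB].
exists (A `&` B) => [|x y [Ax _] [_ By]]; first exact: filterI.
by apply: (AB (x, y)).
Qed.

Lemma closure_subgroup (W : set G) : subgroup W -> subgroup (closure W).
Proof.
move=> [W0 WD]; split; first exact: subset_closure.
move=> x y cx cy B Bxy.
have := @add_continuous G (x, y) B Bxy => -[[A1 A2] /= [A1x A2y] AB].
have [u [Wu Au]] := cx _ A1x; have [v [Wv Av]] := cy _ A2y.
by exists (u + v); split; [exact: WD|exact: (AB (u, v))].
Qed.

(** The complement of [H] is the union of the finitely many closed translates of [H] by the
    representatives outside [H]. *)
Lemma open_finite_index (H : set G) (l : seq G) : subgroup H -> closed H ->
  (forall x, exists2 y, y \in l & H (x + y)) -> open H.
Proof.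
move=> [H0 HD] cH hl.
pose F (s : seq G) := [set z | exists2 y, y \in s & H (z + y)].
have cF s : closed (F s).
  elim: s => [|y s IH].
    by rewrite (_ : F [::] = set0); [exact: closed0|apply/seteqP; split=> // z []].
  rewrite (_ : F (y :: s) = [set z | H (z + y)] `|` F s).
    by apply: closedU => //; exact: closed_shift.
  apply/seteqP; split=> z /=.
    by case=> v; rewrite in_cons => /orP[/eqP ->|vs hv]; [left|right; exists v].
  by case=> [h|[v vs hv]]; [exists y; rewrite ?mem_head|exists v; rewrite // in_cons vs orbT].
rewrite (_ : H = ~` F [seq y <- l | ~~ `[< H y >]]); first exact/closed_openC.
apply/seteqP; split=> z /=.
  move=> Hz [y]; rewrite mem_filter => /andP[/asboolPn Hy _] Hzy; apply: Hy.
  by have := HD _ _ Hz Hzy; rewrite addrA G2 add0r.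
move=> hz; have [y yl hy] := hl z.
have [Hy|Hy] := pselect (H y).
  by have := HD _ _ hy Hy; rewrite -addrA G2 addr0.
by exfalso; apply: hz; exists y => //; rewrite mem_filter yl andbT; apply/asboolPn.
Qed.

Lemma open_subgroup (U : set G) : nbhs 0 U ->
  exists H : set G, [/\ subgroup H, open H & H `<=` U].
Proof.
(* Three halvings: [W] lies in the fourfold sum of [C], hence in [V1]. A point of the closure of [W]
   differs from a point of [W] by an element of [C], which is also in [V1], so the closure lies in
   [U]. *)
move=> /nbhs0_half [V1 V10 hV1]; have [V2 V20 hV2] := nbhs0_half V10.
have [C C0 hC] := nbhs0_half V20.
have c0 : C 0 by exact: nbhs_singleton.
have [a ha] : exists a : seq G, forall x, exists2 y, y \in a & C (x + y).
  have [||a _ ha] := @compact_seq_cover setT (fun y => [set z | interior C (z + y)]) Gc.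
  - by move=> y _; apply: open_shift; exact: open_interior.
  - by move=> x _ /=; rewrite G2; exact: C0.
  exists a => x.
  by have [y ya hy] := ha x Logic.I; exists y => //; exact: interior_subset.
have [W [sW WC hidx]] := @bogolyubov_limit G G2 R C a ha.
have [l hl] := finite_index_reps sW hidx.
exists (closure W); split.
- exact: closure_subgroup.
- apply: (@open_finite_index _ l); [exact: closure_subgroup|exact: closed_closure|].
  by move=> x; have [y yl Wy] := hl x; exists y => //; exact: subset_closure.
- move=> x cx.
  have [w [Ww /= Cw]] : W `&` [set z | C (z + x)] !=set0.
    by apply: cx; apply: nbhs_shift; rewrite G2.
  have [c1 [c2 [c3 [c4 [h1 h2 h3 h4 wE]]]]] := WC _ Ww.
  have -> : x = w + (w + x) by rewrite addrA G2 add0r.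
  apply: hV1; first by rewrite wE; apply: hV2; exact: hC.
  rewrite -[w + x]addr0; apply: hV2; first by rewrite -[w + x]addr0; exact: hC.
  by rewrite -[0]addr0; exact: hC.
Qed.

(** Each [x] in [K] has an open subgroup whose translate by [x] stays in [O]. Finitely many of these
    translates cover [K], and the intersection of their subgroups works uniformly. *)
Lemma open_subgroup_separating (K O : set G) : compact K -> open O -> K `<=` O ->
  exists H : set G, [/\ subgroup H, open H & forall x h, K x -> H h -> O (x + h)].
Proof.
move=> cK oO KO.
have /boolp.choice [H hH] : forall x, exists H : set G, [/\ subgroup H, open H &
    K x -> forall h, H h -> O (x + h)].
  move=> x; have [Kx|nKx] := pselect (K x); last first.
    by have [H [? ? _]] := open_subgroup (filterT : nbhs 0 setT); exists H; split.
  have : nbhs 0 [set z | O (z + x)].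
    by apply: nbhs_shift; rewrite add0r; apply: open_nbhs_nbhs; split=> //; exact: KO.
  move=> /open_subgroup [H [sH oH HU]]; exists H; split=> // _ h /HU.
  by rewrite addrC.
have [||D DK hD] := @compact_seq_cover K (fun x => [set z | H x (z + x)]) cK.
- by move=> x _; apply: open_shift; case: (hH x).
- by move=> x Kx /=; rewrite G2; case: (hH x) => [[]].
have : exists H' : set G, [/\ subgroup H', open H' &
    forall x, x \in D -> H' `<=` H x].
  elim: (D) => [|x s [H' [[H0 HD] oH' hs]]].
    by exists setT; split=> //; exact: openT.
  have [[Hx0 HxD] oHx _] := hH x.
  exists (H x `&` H'); split.
  - split=> // u v [hu hu'] [hv hv']; split; [exact: HxD|exact: HD].
  - exact: openI.
  - move=> y; rewrite in_cons => /orP[/eqP -> z []//|ys z [_]]; exact: hs.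
move=> [H' [sH' oH' hH']]; exists H'; split=> // x h Kx Hh.
have [y /= yD Hxy] := hD _ Kx.
have [[_ HyD] _ HO] := hH y.
have Ky : K y := DK _ yD.
have := HO Ky _ (HyD _ _ Hxy (hH' _ yD _ Hh)).
by rewrite [x + y]addrC -(addrA y x h) (addrA y y) G2 add0r.
Qed.

(** Compactness gives finitely many coset representatives, and [embed_seq] turns them into a
    complement of [H]. Then [pi x] is the unique [t] with [x + psi t] in [H]. *)
Lemma open_subgroup_quotient (H : set G) : subgroup H -> open H ->
  exists (T : finZmodType) (p : T -> T -> bool) (pi : G -> T),
    [/\ f2_pairing p, forall x y, pi (x + y) = pi x + pi y,
        forall t, exists x, pi x = t & forall x, pi x = 0 <-> H x].
Proof.
move=> sH oH; have [H0 HD] := sH.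
have [l hl] : exists l : seq G, forall x, exists2 y, y \in l & H (x + y).
  have [||a _ ha] := @compact_seq_cover setT (fun y => [set z | H (z + y)]) Gc.
  - by move=> y _; apply: open_shift.
  - by move=> x _ /=; rewrite G2.
  by exists a => x; have [y ya hy] := ha x Logic.I; exists y.
have [T [p [psi [[hp psiD psiH] hpsi]]]] := embed_seq G2 l sH.
have /boolp.choice [pi hpi] : forall x, exists t, H (x + psi t).
  move=> x; have [y yl Hy] := hl x; have [t ht] := hpsi _ yl; exists t.
  by have := HD _ _ Hy ht; rewrite addxxK2.
have uniq x s t : H (x + psi s) -> H (x + psi t) -> s = t.
  move=> hs ht; have := HD _ _ hs ht; rewrite [x + psi s]addrC addxxK2 // -psiD.
  move=> /psiH st; apply: (addIr t).
  by rewrite st (addxx hp).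
have psi0 : psi 0 = 0 by apply: (addrI (psi 0)); rewrite -psiD !addr0.
exists T, p, pi; split=> //.
- move=> x y; apply: (uniq (x + y)); first exact: hpi.
  by rewrite psiD addrACA; apply: HD.
- move=> t; exists (psi t); apply: (uniq (psi t)); first exact: hpi.
  by rewrite G2.
- move=> x; split=> [px|Hx]; first by have := hpi x; rewrite px psi0 addr0.
  by apply: (uniq x); [exact: hpi|rewrite psi0 addr0].
Qed.

End OpenSubgroups.

(** * Haar measure and finite quotients *)

Section HaarQuotient.
Variables (R : realType) (G : topologicalZmodType).
Variable mu : {measure set (borel G) -> \bar R}.
Hypothesis hmu : haar_probability mu.

Definition haar (B : set (borel G)) : R := fine (mu B).

Lemma measurable_open (O : set G) : open O -> measurable (O : set (borel G)).
Proof. by move=> oO; apply: sub_sigma_algebra. Qed.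

Lemma haar_fin (B : set (borel G)) : measurable B -> mu B \is a fin_num.
Proof.
case: hmu => mu1 _ _ mB; rewrite ge0_fin_numE //.
apply: le_lt_trans (_ : (1 < +oo)%E); last exact: ltry.
by rewrite -mu1; apply: le_measure; rewrite ?inE.
Qed.

Lemma haarE (B : set (borel G)) : measurable B -> mu B = (haar B)%:E.
Proof. by move=> mB; rewrite /haar fineK // haar_fin. Qed.

Lemma haar_ge0 (B : set (borel G)) : 0 <= haar B.
Proof. exact: fine_ge0. Qed.

Lemma haar_setT : haar setT = 1.
Proof. by case: hmu => mu1 _ _; rewrite /haar mu1. Qed.

Lemma le_haar (B C : set (borel G)) : measurable B -> measurable C ->
  B `<=` C -> haar B <= haar C.
Proof.
move=> mB mC BC; rewrite -lee_fin -!haarE //.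
by apply: le_measure; rewrite ?inE.
Qed.

Lemma haarU (B C : set (borel G)) : measurable B -> measurable C ->
  B `&` C = set0 -> haar (B `|` C) = haar B + haar C.
Proof.
move=> mB mC BC; apply: EFin_inj; rewrite EFinD -!haarE //; last exact: measurableU.
exact: measureU.
Qed.

Lemma haarD (B C : set (borel G)) : measurable B -> measurable C ->
  B `<=` C -> haar (C `\` B) = haar C - haar B.
Proof.
move=> mB mC BC; apply: EFin_inj.
rewrite EFinB -!haarE //; last exact: measurableD.
rewrite measureD ?(setIidr BC) //.
by rewrite -ge0_fin_numE // haar_fin.
Qed.

Variables (T : finZmodType) (p : T -> T -> bool) (pi : G -> T).
Hypothesis hp : f2_pairing p.
Hypothesis piD : forall x y, pi (x + y) = pi x + pi y.
Hypothesis pi_surj : forall t, exists x, pi x = t.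
Hypothesis pi_open : open [set x | pi x = 0].

Definition fiber (t : T) : set (borel G) := [set x | pi x = t].

Lemma open_fiber t : open (fiber t : set G).
Proof.
have [x xt] := pi_surj t.
rewrite (_ : fiber t = [set z | [set x | pi x = 0] (z + x)]); first exact: open_shift.
apply/seteqP; split=> z; rewrite /fiber /= piD xt; first by move=> ->; exact: (addxx hp).
by move=> h; apply: (addIr t); rewrite h (addxx hp).
Qed.

Lemma measurable_fiber t : measurable (fiber t).
Proof. by apply: measurable_open; exact: open_fiber. Qed.

Lemma haar_sum_fiber (X : set (borel G)) : measurable X ->
  haar X = \sum_t haar (X `&` fiber t).
Proof.
move=> mX; pose F (s : seq T) : set (borel G) := [set x | pi x \in s].
have FE t s : F (t :: s) = fiber t `|` F s.
  apply/seteqP; split=> x /=; rewrite /F /fiber /= in_cons.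
    by case/orP=> [/eqP|]; [left|right].
  by case=> [->|->]; rewrite ?eqxx ?orbT.
have mF s : measurable (F s).
  elim: s => [|t s IH].
    by rewrite (_ : F [::] = set0) //; apply/seteqP; split.
  by rewrite FE; apply: measurableU => //; exact: measurable_fiber.
have key s : uniq s -> haar (X `&` F s) = \sum_(t <- s) haar (X `&` fiber t).
  elim: s => [_|t s IH /= /andP[ts us]].
    rewrite big_nil (_ : X `&` F [::] = set0) /haar ?measure0 //.
    by apply/seteqP; split=> // x [].
  rewrite big_cons -IH // FE setIUr haarU //.
  - by apply: measurableI => //; exact: measurable_fiber.
  - exact: measurableI.
  - apply/seteqP; split=> // x [[_ +] [_]]; rewrite /fiber /F /= => ->.
    by rewrite (negbTE ts).
have := key (enum T) (enum_uniq _); rewrite big_enum /= => <-; congr haar.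
by apply/seteqP; split=> x; [move=> Xx; split=> //; rewrite /F /= mem_enum|case].
Qed.

Lemma haar_fiber t : haar (fiber t) = #|T|%:R^-1.
Proof.
have e u : haar (fiber u) = haar (fiber 0).
  have [x xu] := pi_surj u; case: hmu => _ tr _; rewrite /haar.
  rewrite -(tr x _ (measurable_fiber 0)); congr (fine (mu _)).
  apply/seteqP; split=> [z /= zu|_ [y /= y0 <-]].
    exists (z - x); last by rewrite addrC subrK.
    by apply: (addIr (pi x)); rewrite -piD subrK add0r xu.
  by rewrite /fiber /= in y0 *; rewrite piD xu y0 addr0.
have := haar_sum_fiber measurableT; rewrite haar_setT.
under eq_bigr do rewrite setTI e.
rewrite sumr_const -[_ *+ _]mulr_natr e => h.
by apply: (mulIf (lt0r_neq0 (card_gt0R R T))); rewrite -h mulVf ?lt0r_neq0 ?card_gt0R.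
Qed.

Variable A : set (borel G).
Hypothesis mA : measurable A.

(** The average of the indicator of [A] over a fibre, whose measure is [#|T|%:R^-1] by
    [haar_fiber]. *)
Definition density (t : T) : R := #|T|%:R * haar (A `&` fiber t).

Lemma density_itv t : 0 <= density t <= 1.
Proof.
rewrite /density mulr_ge0 ?haar_ge0 //=.
rewrite -ler_pdivlMl ?card_gt0R // mulr1 -(haar_fiber t).
apply: le_haar => //; [apply: measurableI => //|]; exact: measurable_fiber.
Qed.

Lemma mean_density : mean density = haar A.
Proof.
by rewrite /mean -big_distrr /= mulKf ?lt0r_neq0 ?card_gt0R // -haar_sum_fiber.
Qed.

Lemma integrable_haar_indic (B : set (borel G)) : measurable B ->
  mu.-integrable setT (fun x => (\1_B x)%:E).
Proof.
move=> mB; apply/integrableP; split.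
  by apply/measurable_EFinP; exact: measurable_indic.
rewrite (eq_integral (fun x => (\1_B x)%:E)); last first.
  by move=> x _; rewrite gee0_abs // lee_fin.
by rewrite integral_indic // setIT -ge0_fin_numE // haar_fin.
Qed.

Lemma Rintegral_fibers (c : T -> R) :
  Rintegral mu setT (fun x => \1_A x * c (pi x)) = \sum_t haar (A `&` fiber t) * c t.
Proof.
rewrite /Rintegral (eq_integral (fun x => \sum_t ((c t)%:E * (\1_(A `&` fiber t) x)%:E))%E).
  rewrite integral_sum //; last first.
    move=> t; apply: integrableZl => //; apply: integrable_haar_indic.
    by apply: measurableI => //; exact: measurable_fiber.
  rewrite (eq_bigr (fun t => (haar (A `&` fiber t) * c t)%:E)) ?sumEFin // => t _.
  have mI : measurable (A `&` fiber t) by apply: measurableI => //; exact: measurable_fiber.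
  rewrite integralZl //; last exact: integrable_haar_indic.
  by rewrite integral_indic // setIT haarE // -EFinM mulrC.
move=> x _; under eq_bigr do rewrite -EFinM.
rewrite sumEFin; congr (_%:E).
rewrite (bigD1 (pi x)) //= big1 ?addr0 => [|t tx].
  rewrite mulrC; congr (_ * _); rewrite !indicE; congr (_%:R); congr nat_of_bool.
  by apply/idP/idP; rewrite !inE; [split|case].
rewrite indicE; case: (boolP (x \in _)); rewrite ?mulr0 // inE => -[_].
by rewrite /fiber /= => xt; move: tx; rewrite xt eqxx.
Qed.

Lemma Rintegral_chi w :
  Rintegral mu setT (fun x => \1_A x * chi R p w (pi x)) = hat p density w.
Proof.
rewrite Rintegral_fibers /hat /mean big_distrr /=; apply: eq_bigr => t _.
by rewrite /density -!mulrA mulKf ?lt0r_neq0 ?card_gt0R.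
Qed.

(** The characters of [G] that factor through [pi]; on these, the Fourier transform of the indicator
    of [A] is that of [density]. *)
Definition dchar (w : T) : G -> R[i] := fun x => (-1) ^+ p w (pi x).

Lemma dcharE w x : dchar w x = ((chi R p w (pi x))%:C)%C.
Proof. by rewrite /dchar /chi rmorphXn /= rmorphN1. Qed.

Lemma dchar_dual w : @dual R G (dchar w).
Proof.
split.
- move=> x B /nbhs_singleton Bx.
  apply: (@filterS _ _ _ (fiber (pi x))).
    by move=> z; rewrite /fiber /= => zx; rewrite /dchar zx.
  by apply: open_nbhs_nbhs; split; [exact: open_fiber|].
- by move=> x; rewrite /dchar normrX normrN1 expr1n.
- by move=> x y; case: hp => _ pD _; rewrite /dchar piD pD signr_addb.
Qed.

Lemma dcharD w v : dchar (w + v) = (fun x => dchar w x * dchar v x).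
Proof.
by apply/funext => x; rewrite !dcharE (chiDl R hp) rmorphM.
Qed.

Lemma dchar_inj : injective dchar.
Proof.
move=> w v wv; apply/eqP; rewrite -subr_eq0; apply/contraT => h.
have [pC pD pn] := hp.
have [t pt] := pn _ h; have [x xt] := pi_surj t.
have := congr1 (fun f => f x) wv; rewrite /dchar xt => /eqP.
have -> : p w t = ~~ p v t.
  by have := pD t (w - v) v; rewrite subrK pt (pC t w) (pC t v) addTb.
by case: (p v t); rewrite /= ?expr0 ?expr1 ?eqr_oppLR ?oner_eq0 // ?eqNr ?oner_eq0 // eq_sym eqNr oner_eq0.
Qed.

Lemma normc_fourier_dchar w :
  ComplexField.Normc.normc (fourier mu (cindic R A) (dchar w)) = `|hat p density w|.
Proof.
rewrite /fourier /cintegral -Rintegral_chi.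
rewrite (_ : (fun x => complex.Re (cindic R A x * (dchar w x)^*)) =
  (fun x => \1_A x * chi R p w (pi x))); last first.
  apply/funext => x; rewrite dcharE /cindic /=; ring.
rewrite (_ : (fun x => complex.Im (cindic R A x * (dchar w x)^*)) = fun=> 0); last first.
  apply/funext => x; rewrite dcharE /cindic /=; ring.
have -> : Rintegral mu setT (fun=> 0) = 0 by rewrite /Rintegral integral0.
by rewrite rmorph0 mulr0 addr0 /= expr0n /= addr0 sqrtr_sqr.
Qed.

Lemma card_dchar (W : {set T}) : card_set (dchar @` [set` W]) = #|W|.
Proof.
have fW : finite_set (dchar @` [set` W]) by apply: finite_image.
rewrite cardE -(size_map dchar); apply: perm_size; apply: uniq_perm.
- exact: finmap.fset_uniq.
- by rewrite map_inj_uniq ?enum_uniq //; exact: dchar_inj.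
move=> g; rewrite [LHS](in_fset_set fW); apply/idP/mapP.
  by rewrite inE => -[w /= wW <-]; exists w; rewrite ?mem_enum.
by move=> [w]; rewrite mem_enum => wW ->; rewrite inE; exists w.
Qed.

Lemma finite_subgroup_dchar (W : {set T}) : subgrp W ->
  finite_subgroup_dual (dchar @` [set` W]).
Proof.
move=> [W0 WD]; split.
- exact: finite_image.
- by move=> _ [w _ <-]; exact: dchar_dual.
- exists 0 => //; apply/funext => x; rewrite dcharE (chi0l R hp) //.
- move=> _ _ [w /= wW <-] [v /= vW <-]; exists (w + v); first exact: WD.
  exact: dcharD.
- move=> _ [w wW <-]; exists w => //; apply/funext => x.
  by rewrite /dchar invr_sign.
Qed.

Lemma sum_hat_le_Anorm :
  ((\sum_w `|hat p density w|)%:E <= Anorm mu (cindic R A))%E.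
Proof.
apply: esum_ge; exists (dchar @` [set` (finset.setT : {set T})]).
  by split; [exact: finite_image|move=> _ [w _ <-]; exact: dchar_dual].
rewrite fsbig_image; last by move=> w v _ _; exact: dchar_inj.
rewrite -sumEFin fsbig_finite //.
rewrite [leRHS](eq_bigr (fun w => `|hat p density w|%:E)); last first.
  by move=> w _; rewrite normc_fourier_dchar.
rewrite le_eqVlt; apply/orP; left; apply/eqP.
rewrite -big_enum /=; apply: perm_big; apply: uniq_perm.
- exact: enum_uniq.
- exact: finmap.fset_uniq.
- move=> w; rewrite mem_enum [RHS](in_fset_set _) //.
  by apply/esym/mem_set; rewrite /= finset.in_setT.
Qed.

Lemma sawtooth_hyp (delta M : R) :
  (forall V : set (G -> R[i]), finite_subgroup_dual V -> (card_set V)%:R <= M ->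
     delta <= fracpart (fine (mu A) * (card_set V)%:R)
              * (1 - fracpart (fine (mu A) * (card_set V)%:R))) ->
  forall W : {set T}, subgrp W -> #|W|%:R <= M ->
    delta <= sawtooth (mean density * #|W|%:R).
Proof.
move=> h W sW; have := h _ (finite_subgroup_dchar sW).
by rewrite card_dchar mean_density.
Qed.

(** A fibre meeting [K] misses [K'], so its part outside [A] is charged to the complement of [A]
    minus [K']. On any other fibre the part in [A] is charged to [A] minus [K]. *)
Lemma density_near_indicator (K K' : set (borel G)) :
  measurable K -> measurable K' -> K `<=` A -> K' `<=` ~` A ->
  (forall x y, K x -> K' y -> pi x <> pi y) ->
  mean (fun t => density t * (1 - density t)) <= haar A - haar K + (1 - haar A - haar K').
Proof.
move=> mK mK' KA KA' KK'.
have mF := measurable_fiber.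
have mAC : measurable (~` A) by exact: measurableC.
have hC : haar (~` A) = 1 - haar A by rewrite -haar_setT -haarD // setTD.
rewrite -hC -!haarD //.
have mD1 : measurable (A `\` K) by exact: measurableD.
have mD2 : measurable (~` A `\` K') by exact: measurableD.
rewrite (haar_sum_fiber mD1) (haar_sum_fiber mD2) -big_split /= /mean big_distrr /=.
apply: ler_sum => t _.
have /andP[d0 d1] := density_itv t.
have N0 := card_gt0R R T.
have e1 : 1 - density t = #|T|%:R * haar (~` A `&` fiber t).
  have := haar_fiber t.
  rewrite -[X in haar X](setIT (fiber t)) -(setUv A) setIUr ![fiber t `&` _]setIC.
  rewrite haarU //; [|exact: measurableI|exact: measurableI|].
    by move=> h; have := mulfV (lt0r_neq0 N0); rewrite -h /density mulrDr; lra.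
  by rewrite setIACA setICr set0I.
have [[x [Kx xt]]|hno] := pselect (exists x, K x /\ pi x = t).
  apply: le_trans (_ : haar ((~` A `\` K') `&` fiber t) <= _); last by rewrite lerDr haar_ge0.
  rewrite (_ : (~` A `\` K') `&` fiber t = ~` A `&` fiber t); last first.
    apply/seteqP; split=> y [h1 h2]; split=> //; first by case: h1.
    by split=> // K'y; apply: (KK' x y) => //; rewrite xt h2.
  rewrite ler_pdivrMl // -e1 ler_piMl //; lra.
apply: le_trans (_ : haar ((A `\` K) `&` fiber t) <= _); last by rewrite lerDl haar_ge0.
rewrite (_ : (A `\` K) `&` fiber t = A `&` fiber t); last first.
  apply/seteqP; split=> y [h1 h2]; split=> //; first by case: h1.
  by split=> // Ky; apply: hno; exists y.
rewrite ler_pdivrMl // -/(density t) ler_piMr //; lra.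
Qed.

End HaarQuotient.

(** * Inner approximation by compact sets and reduction to a finite quotient *)

Lemma haar_compact_approx (R : realType) (G : topologicalZmodType)
    (mu : {measure set (borel G) -> \bar R}) (B : set (borel G)) (e : R) :
  compact_F2_space G -> haar_probability mu -> measurable B -> 0 < e ->
  exists K : set G, [/\ compact K, measurable (K : set (borel G)), K `<=` B &
    haar mu B - haar mu K <= e].
Proof.
move=> [_ hG _] hmu mB e0; have [_ _ reg] := hmu.
have := haar_fin hmu mB; rewrite (reg B mB) => hfin.
have [_ [K [cK KB] <-] hK] := ub_ereal_sup_adherent e0 hfin.
have mK : measurable (K : set (borel G)).
  rewrite -[K]setCK; apply: measurableC; apply: measurable_open.
  by apply: closed_openC; exact: compact_closed.
exists K; split=> //.
move: hK; rewrite -(reg B mB) (haarE hmu mB) (haarE hmu mK) -EFinB lte_fin => /ltW.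
by lra.
Qed.

Unset Implicit Arguments.

Theorem theorem2p4 (R : realType) (delta : R) (hdelta : 0 < delta) :
  exists c : R, 0 < c /\
  forall (G : topologicalZmodType) (mu : {measure set (borel G) -> \bar R})
         (M : R) (A : set (borel G)),
    compact_F2_space G -> haar_probability mu -> 16 <= M -> measurable A ->
    (forall V : set (G -> R[i]), finite_subgroup_dual V ->
       (card_set V)%:R <= M ->
       delta <= fracpart (fine (mu A) * (card_set V)%:R)
                * (1 - fracpart (fine (mu A) * (card_set V)%:R))) ->
    ((c * ln (ln M))%:E <= Anorm mu (cindic R A))%E.
Proof.
exists (560 + `|ln (ln (2 / delta))| / delta)^-1; split.
  by rewrite invr_gt0 ltr_pwDl ?ltr0n // divr_ge0 ?(ltW hdelta).
move=> G mu M A hG hmu hM mA hV; have [Gc _ G2] := hG.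
have M1 : 1 < M by lra.
(* [A] and its complement are each approximated within this error; together they use up the
   tolerance [delta / (2 * M)] of [finite_loglog]. *)
have e0 : 0 < delta / (4 * M) by rewrite divr_gt0 // mulr_gt0 //; lra.
have mAC : measurable (~` A) by exact: measurableC.
have [K [cK mK KA hK]] := haar_compact_approx hG hmu mA e0.
have [K' [cK' mK' KA' hK']] := haar_compact_approx hG hmu mAC e0.
have oO : open (~` K') by apply: closed_openC; apply: compact_closed => //; case: hG.
have KO : K `<=` ~` K' by move=> x /KA Ax /KA'.
have [H [sH oH HO]] := open_subgroup_separating R G2 Gc cK oO KO.
have [T [p [pi [hp piD pis piH]]]] := open_subgroup_quotient G2 Gc sH oH.
have pio : open [set x | pi x = 0].
  by rewrite (_ : [set x | pi x = 0] = H) //; apply/seteqP; split=> x /piH.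
(* If [pi x = pi y], then [x + y] is in [H], and [y = x + (x + y)] would avoid [K']. *)
have sep x y : K x -> K' y -> pi x <> pi y.
  move=> Kx K'y xy; apply: (HO x (x + y) Kx _).
    by apply/piH; rewrite piD xy (addxx hp).
  by rewrite addrA G2 add0r.
have hmean := density_near_indicator hmu hp piD pis pio mA mK mK' KA KA' sep.
apply: le_trans (sum_hat_le_Anorm hmu hp piD pis pio mA).
rewrite lee_fin; apply: (finite_loglog hp) => //.
- move=> t; exact: (density_itv hmu hp piD pis pio mA).
- apply: le_trans hmean _; move: hK'.
  have -> : haar mu (~` A) = 1 - haar mu A.
    by rewrite -(haar_setT hmu) -haarD // setTD.
  have -> : delta / (2 * M) = delta / (4 * M) + delta / (4 * M) by field; lra.
  by lra.
- exact: (sawtooth_hyp hmu hp piD pis pio mA hV).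
Qed.
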